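(* Let $(W,S)$ be a tubular elliptic Weyl system with hyperbolic covers $(\tilde W,\tilde S)$ and $(\hat W,\hat S)$. Then the following hold. (a) The group $\tilde W$ is a non-split central extension of $W$ by $\langle\tilde E(a\otimes b)\rangle=\tilde E(a\otimes\mathbb Zb)\cong\mathbb Z$. (b) The groups $\tilde W$ and $\hat W$ are isomorphic.
   Context: Root systems. Let $V$ be a finite-dimensional real vector space with a symmetric bilinear form $(-\mid-)$ with radical $R$. For a vector $\alpha$ with $(\alpha\mid\alpha)\ne0$ put $s_\alpha(v)=v-\frac{2(\alpha\mid v)}{(\alpha\mid\alpha)}\alpha$. A generalized root system is a non-empty set $\Phi\subseteq V$ of non-isotropic vectors with $\mathrm{span}_{\mathbb R}(\Phi)=V$, $s_\alpha(\Phi)\subseteq\Phi$ for all $\alpha\in\Phi$, and $\frac{2(\alpha\mid\beta)}{(\beta\mid\beta)}\in\mathbb Z$ for all $\alpha,\beta\in\Phi$; its root lattice $L(\Phi)=\mathrm{span}_{\mathbb Z}(\Phi)$ is a lattice in $V$ (generated by an $\mathbb R$-basis of $V$). It is reduced if $r\alpha\in\Phi$ ($\alpha\in\Phi$, $r\in\mathbb R$) implies $r=\pm1$, and irreducible if it is not a union of two mutually orthogonal generalized root systems. It is elliptic if it is irreducible and reduced and $(-\mid-)$ has signature $(n,0,2)$ (numbers of positive, negative, zero eigenvalues), $n+2=\dim V$. Standing assumption: $(\alpha\mid\alpha)=2$ for all $\alpha\in\Phi$. Choices. Fix a $1$-dimensional subspace $U\le R$ with $U\cap L(\Phi)\ne\{0\}$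 and $a$ with $L(\Phi)\cap U=\mathbb Za$. The image $\Phi/U$ of $\Phi$ in $V/U$ is an irreducible affine root system; let $\beta_0,\dots,\beta_n$ be a root basis (simple system) of it such that $\beta_1,\dots,\beta_n$ is a root basis of a finite root system ($\beta_0$ being the affine node in the standard numbering), and let $m_1,\dots,m_n$ be the unique positive integers such that $\beta_0+\sum_{i=1}^n m_i\beta_i$ spans $L(\Phi/U)\cap R/U$; put $m_0=1$. Choose preimages $\alpha_i\in\Phi$ of $\beta_i$ and put $b=\sum_{i=0}^n m_i\alpha_i\in R$, $V_{\mathrm{fin}}=\sum_{i=1}^n\mathbb R\alpha_i$. Tubular case. $\Phi$ is tubular if exactly one index $t$ satisfies $m_t=\max_i m_i$; then put $\alpha_{t^\star}=\alpha_t+a$, $M=\{0,\dots,n,t^\star\}$, $s_i=s_{\alpha_i}$, $S=\{s_i\mid i\in M\}$ and $W=\langle s_\alpha\mid\alpha\in\Phi\rangle\le \mathrm{GL}(V)$; $(W,S)$ is called a tubular elliptic Weyl system. Hyperbolic covers. Let $\hat V\supseteq V$ be the space with non-degenerate form of signature $(n+2,2,0)$ extending that of $V$, $\hat V=V_{\mathrm{fin}}\perp\langle a,a'\rangle\perp\langle b,b'\rangle$ with $(a,a'),(b,b')$ hyperbolic pairs (isotropic vectors with product $1$), and let $\tilde V=V\oplus\mathbb Rb'\subset\hat V$. For $i\in M$ let $\tilde s_i$ and $\hat s_i$ be the reflections of $\tilde V$ and of $\hat V$ with respect to $\alpha_i$; $\tilde S=\{\tilde s_i\mid i\in M\}$,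 $\tilde W=\langle\tilde S\rangle$, $\hat S=\{\hat s_i\mid i\in M\}$, $\hat W=\langle\hat S\rangle$. The extension in (a) is with respect to the restriction epimorphism $\varphi:\tilde W\to W$, $w\mapsto w|_V$. The Eichler–Siegel map $\tilde E:V\otimes_{\mathbb Z}V/U\to\mathrm{End}(\tilde V)$ is given by $\sum_if_i\otimes g_i\mapsto\left(v\mapsto v-\sum_i(g_i\mid v)f_i\right)$ (well defined as $U$ lies in the radical of $\tilde V$); in particular $\tilde E(a\otimes kb)(v)=v-k(b\mid v)a$. *)

(* Defs.v *)
From HB Require Import structures.
From mathcomp Require Import all_boot all_order all_algebra.
From mathcomp Require Import sesquilinear.
From mathcomp Require Import all_classical reals.

Set Implicit Arguments.
Unset Strict Implicit.
Unset Printing Implicit Defensive.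
Import Order.TTheory GRing.Theory Num.Theory.
Local Open Scope classical_set_scope.
Local Open Scope ring_scope.

Section Groups.
Variables G H : groupType.

Definition subgroup (A : set G) : Prop :=
  [/\ A 1%g, forall x y, A x -> A y -> A (x * y)%g & forall x, A x -> A x^-1%g].

Definition generated (A : set G) : set G := smallest subgroup A.

Definition hom_on (A : set G) (h : G -> H) : Prop :=
  forall x y, A x -> A y -> h (x * y)%g = (h x * h y)%g.

Definition isomorphic (A : set G) (B : set H) : Prop :=
  exists2 h : G -> H, hom_on A h & set_bij A B h.

Definition infinite_cyclic (A : set G) : Prop :=
  exists2 h : int -> G,
    (forall i j, h (i + j) = (h i * h j)%g) & set_bij [set: int] A h.

(* [phi] exhibits the subgroup [E] of [G] as a central extension of the
   subgroup [Q] of [H] by the subgroup [N] of [G]. *)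
Definition central_extension (E : set G) (Q : set H) (N : set G)
    (phi : G -> H) : Prop :=
  [/\ hom_on E phi, phi @` E = Q, E `&` phi @^-1` [set 1%g] = N
    & forall x y, N x -> E y -> commute x y].

End Groups.

Definition split_extension (G H : groupType) (E : set G) (Q : set H)
    (phi : G -> H) : Prop :=
  exists sigma : H -> G,
    [/\ hom_on Q sigma, forall q, Q q -> E (sigma q)
      & forall q, Q q -> phi (sigma q) = q].

Section GeneralLinear.
Variables (K : fieldType) (V : vectType K).

Record GL := MkGL { gl_val :> 'End(V); gl_ker : lker gl_val == 0%VS }.

HB.instance Definition _ := [isSub for gl_val].
HB.instance Definition _ := [Choice of GL by <:].

Fact GL_one_proof : lker (\1%VF : 'End(V)) == 0%VS.
Proof. by apply/lker0P => x y; rewrite !lfunE. Qed.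

Fact GL_mul_proof (g h : GL) : lker (gl_val g \o gl_val h)%VF == 0%VS.
Proof.
apply/lker0P => x y; rewrite !lfunE /=.
by move=> /(lker0P (gl_ker g)) /(lker0P (gl_ker h)).
Qed.

Fact GL_inv_proof (g : GL) : lker (gl_val g)^-1%VF == 0%VS.
Proof. exact/lker0P/(can_inj (lker0_lfunVK (gl_ker g))). Qed.

Definition GL_one := MkGL GL_one_proof.
Definition GL_mul g h := MkGL (GL_mul_proof g h).
Definition GL_inv g := MkGL (GL_inv_proof g).

Fact GL_mulA : associative GL_mul.
Proof. by move=> g h k; apply: val_inj; rewrite /= comp_lfunA. Qed.
Fact GL_mul1g : left_id GL_one GL_mul.
Proof. by move=> g; apply: val_inj; rewrite /= comp_lfun1l. Qed.
Fact GL_mulg1 : right_id GL_one GL_mul.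
Proof. by move=> g; apply: val_inj; rewrite /= comp_lfun1r. Qed.
Fact GL_mulVg : left_inverse GL_one GL_inv GL_mul.
Proof. by move=> g; apply: val_inj; rewrite /= lker0_compVf // gl_ker. Qed.
Fact GL_mulgV : right_inverse GL_one GL_inv GL_mul.
Proof. by move=> g; apply: val_inj; rewrite /= lker0_compfV // gl_ker. Qed.

HB.instance Definition _ := isGroup.Build GL GL_mulA GL_mul1g GL_mulg1
  GL_mulVg GL_mulgV.

End GeneralLinear.

Section RestrictedForm.
Variables (K : fieldType) (V : vectType K) (f : {symmetric V}).
Variable E : {vspace V}.

Definition restr_form (x y : subvs_of E) : K := f (vsval x) (vsval y).

Fact restr_form_bilinear :
  bilinear_for ( *%R : K -> K -> K) ( *%R : K -> K -> K) restr_form.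
Proof.
by split=> u k x y; rewrite /restr_form linearP //= linearPl.
Qed.

HB.instance Definition _ := bilinear_isBilinear.Build K (subvs_of E)
  (subvs_of E) K *%R *%R restr_form restr_form_bilinear.

Fact restr_form_symmetric x y :
  restr_form x y = (-1) ^+ false * idfun (restr_form y x).
Proof. by rewrite /restr_form hermC. Qed.

HB.instance Definition _ := isHermitianSesquilinear.Build K (subvs_of E)
  false idfun restr_form restr_form_symmetric.

End RestrictedForm.

Section Forms.
Variables (R : realType) (V : vectType R) (f : {symmetric V}).
Implicit Types (E : {vspace V}) (Phi : set V).

Definition refl (x v : V) : V := v - (2 * f x v / f x x) *: x.

Definition weyl_group (A : set V) : set (GL V) :=
  generated [set g : GL V | exists2 x, A x & g =1 refl x].

Definition gram k (e : k.-tuple V) : 'M[R]_k :=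
  \matrix_(i, j) f (tnth e i) (tnth e j).

(* Numbers [p], [q], [z] of positive, negative and zero eigenvalues, with
   multiplicity, of the Gram matrix; by Sylvester's law of inertia they do not
   depend on the basis. *)
Definition has_signature (p q z : nat) : Prop :=
  forall e : (\dim {:V}).-tuple V, basis_of fullv e ->
  exists s : seq R,
    [/\ char_poly (gram e) = \prod_(x <- s) ('X - x%:P),
        count (fun x => 0 < x) s = p, count (fun x => x < 0) s = q
      & count (fun x => x == 0) s = z].

Definition zspan (A : set V) : set V :=
  [set v | exists2 s : seq (int * V), (forall p, p \in s -> A p.2)
                                    & v = \sum_(p <- s) p.2 *~ p.1].

Definition rspan (A : set V) : set V :=
  [set v | exists2 s : seq V, (forall x, x \in s -> A x) & v \in <<s>>%VS].

(* The ambient space is a subspace [E] of [V], so that one can speak of root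
   systems contained in another one and spanning less. *)
Record generalized_root_system E Phi : Prop := {
  grs_nonempty : Phi !=set0;
  grs_nonisotropic : forall x, Phi x -> f x x != 0;
  grs_span : rspan Phi = [set` E];
  grs_refl : forall x y, Phi x -> Phi y -> Phi (refl x y);
  grs_int : forall x y, Phi x -> Phi y -> 2 * f x y / f y y \is a Num.int;
  grs_lattice : exists2 e : seq V, basis_of E e & zspan Phi = zspan [set` e]
}.

Definition reduced Phi : Prop :=
  forall x (r : R), Phi x -> Phi (r *: x) -> r = 1 \/ r = -1.

Definition irreducible Phi : Prop :=
  ~ exists Phi1 Phi2 E1 E2,
      [/\ generalized_root_system E1 Phi1, generalized_root_system E2 Phi2,
          Phi = Phi1 `|` Phi2 & forall x y, Phi1 x -> Phi2 y -> f x y = 0].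

Record elliptic (n : nat) Phi : Prop := {
  ell_grs : generalized_root_system fullv Phi;
  ell_irreducible : irreducible Phi;
  ell_reduced : reduced Phi;
  ell_dim : \dim {:V} = n.+2;
  ell_signature : has_signature n 0 2
}.

Definition root_basis k Phi (beta : 'I_k -> V) : Prop :=
  [/\ forall i, Phi (beta i), free (codom beta)
    & forall x, Phi x -> exists c : 'I_k -> nat,
        x = \sum_i beta i *+ c i \/ x = - \sum_i beta i *+ c i].

Record marking Phi (U : {vspace V}) (a : V) : Prop := {
  mark_dim : \dim U = 1%N;
  mark_radical : (U <= orthov f fullv)%VS;
  mark_lattice : exists2 v, v != 0 & zspan Phi v /\ v \in U;
  mark_gen : zspan Phi `&` [set` U] = zspan [set a]
}.

Definition hyperbolic_pair (x y : V) : Prop :=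
  [/\ f x x = 0, f y y = 0 & f x y = 1].

Definition orthogonal_decomposition3 (E1 E2 E3 : {vspace V}) : Prop :=
  [/\ (E1 + E2 + E3 = fullv)%VS, directv (E1 + E2 + E3),
      (E1 <= orthov f E2)%VS, (E1 <= orthov f E3)%VS
    & (E2 <= orthov f E3)%VS].

End Forms.

(* [VU], with the form [fU] and the projection [pi], is a model of the quotient
   V/U with the induced form. *)
Definition quotient_space (R : realType) (V VU : vectType R)
    (f : {symmetric V}) (U : {vspace V})
    (fU : {symmetric VU}) (pi : 'Hom(V, VU)) : Prop :=
  [/\ lker pi = U, limg pi = fullv & forall x y, fU (pi x) (pi y) = f x y].

(* [beta] is a root basis of the affine root system Phi/U with affine node
   [beta ord0], and [m] are its marks.  In this simply laced setting the nodes
   with mark 1 form one orbit under the automorphisms of the affine diagram, so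
   [arb_mark0] is what singles out the affine node. *)
Record affine_root_basis (R : realType) (V VU : vectType R)
    (f : {symmetric V}) (fU : {symmetric VU}) (pi : 'Hom(V, VU))
    (Phi : set V) (n : nat) (beta : 'I_n.+1 -> VU) (m : 'I_n.+1 -> nat) :
    Prop := {
  arb_basis : root_basis (pi @` Phi) beta;
  arb_finite : let beta_fin (i : 'I_n) := beta (lift ord0 i) in
    exists Psi, [/\ finite_set Psi, Psi `<=` pi @` Phi,
      generalized_root_system fU <<codom beta_fin>>%VS Psi
      & root_basis Psi beta_fin];
  arb_mark0 : m ord0 = 1%N;
  arb_mark_gt0 : forall i, (0 < m i)%N;
  arb_marks : zspan (pi @` Phi) `&` [set` (pi @: orthov f fullv)%VS]
              = zspan [set \sum_i beta i *+ m i]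
}.

Definition tubular n (m : 'I_n.+1 -> nat) (t : 'I_n.+1) : Prop :=
  forall i, m i = (\max_j m j)%N <-> i = t.

(* The index set {0, ..., n, t*} is [option 'I_n.+1], with [None] for t*. *)
Definition ext_roots (V : zmodType) n (alpha : 'I_n.+1 -> V) (t : 'I_n.+1)
    (a : V) (i : option 'I_n.+1) : V :=
  if i is Some j then alpha j else alpha t + a.

Section HyperbolicCover.
Variables (R : realType) (V hV : vectType R).
Variables (f : {symmetric V}) (hf : {symmetric hV}) (inc : 'Hom(V, hV)).

Record hyperbolic_extension n (Vfin : {vspace V}) (a b : V) (a' b' : hV) :
    Prop := {
  hyp_inj : lker inc = 0%VS;
  hyp_isometry : forall x y, hf (inc x) (inc y) = f x y;
  hyp_nondegenerate : nondegenerate hf;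
  hyp_signature : has_signature hf n.+2 2 0;
  hyp_pair_a : hyperbolic_pair hf (inc a) a';
  hyp_pair_b : hyperbolic_pair hf (inc b) b';
  hyp_decomposition :
    orthogonal_decomposition3 hf (inc @: Vfin)%VS
      (<[inc a]> + <[a']>)%VS (<[inc b]> + <[b']>)%VS
}.

Definition tilde_space (b' : hV) : {vspace hV} := (limg inc + <[b']>)%VS.

Definition tilde_form b' : {symmetric (subvs_of (tilde_space b'))} :=
  @restr_form R hV hf (tilde_space b').

Definition tilde_inj b' (v : V) : subvs_of (tilde_space b') :=
  vsproj (tilde_space b') (inc v).

Lemma tilde_injE b' v : vsval (tilde_inj b' v) = inc v.
Proof.
rewrite vsprojK // -[inc v]addr0.
by apply: memv_add; [exact: memv_img (memvf v) | exact: mem0v].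
Qed.

End HyperbolicCover.

Section EichlerSiegel.
Variables (R : realType) (V T : vectType R).
Variables (F : {symmetric T}) (j : V -> T).

(* The list [s] of pairs (f_i, g_i) stands for the tensor sum_i f_i (x) g_i of
   V (x) V/U, the second components being representatives of classes mod U. *)
Definition Eichler_Siegel (s : seq (V * V)) : 'End(T) :=
  linfun (fun v : T => v - \sum_(p <- s) F (j p.2) v *: j p.1).

Lemma Eichler_SiegelE s v :
  Eichler_Siegel s v = v - \sum_(p <- s) F (j p.2) v *: j p.1.
Proof.
pose h (v : T) := v - \sum_(p <- s) F (j p.2) v *: j p.1.
have hlin : linear h.
  move=> k x y; rewrite /h scalerBr addrACA -opprD scaler_sumr -big_split /=.
  congr (_ - _); apply: eq_bigr => p _.
  by rewrite linearPr scalerDl scalerA.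
pose hL := GRing.isLinear.Build R T T *:%R h hlin.
pose hl : {linear T -> T} := HB.pack h hL.
exact: (lfunE hl v).
Qed.

End EichlerSiegel.

Lemma reflection_GL (R : realType) (V : vectType R) (f : {symmetric V}) x :
  f x x != 0 -> exists g : GL V, g =1 refl f x.
Proof.
move=> fx0.
have hlin : linear (refl f x).
  move=> k u v; rewrite /refl scalerBr addrACA -opprD scalerA -scalerDl.
  by rewrite linearPr /= mulrDr mulrDl [2 * (k * _)]mulrCA -!mulrA.
pose hL := GRing.isLinear.Build R V V *:%R (refl f x) hlin.
pose hl : {linear V -> V} := HB.pack (refl f x) hL.
have hK : involutive (refl f x).
  move=> v; rewrite {1}/refl; set c := 2 * f x (refl f x v) / f x x.
  have -> : c = - (2 * f x v / f x x).
    rewrite /c /refl linearBr linearZr /= divfK //.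
    have -> : f x v - 2 * f x v = - f x v.
      by rewrite mulr_natl mulr2n opprD addrA subrr add0r.
    by rewrite mulrN mulNr.
  by rewrite scaleNr opprK /refl subrK.
have hker : lker (linfun hl) == 0%VS.
  by apply/lker0P => u v; rewrite !lfunE /=; exact: (can_inj hK).
by exists (MkGL hker) => v; rewrite /= (lfunE hl).
Qed.

(* Main.v *)
Require Import Defs.
From HB Require Import structures.
From mathcomp Require Import all_boot all_order all_algebra.
From mathcomp Require Import sesquilinear.
From mathcomp Require Import all_classical reals.
From mathcomp Require Import ring lra zify.

Set Implicit Arguments.
Unset Strict Implicit.
Unset Printing Implicit Defensive.
Import Order.TTheory GRing.Theory Num.Theory.
Local Open Scope classical_set_scope.
Local Open Scope ring_scope.

(** The argument has three parts.

    Generation.  Put [E x : v |-> v - (x | v) a].  If the reflections in [x] and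
    [x + a] lie in [tilde W], so does [E x = s_x s_(x+a)]
    ([transvected_of_reflected]), and [E] is additive and equivariant under
    [tilde W].  The roots [alpha t] and [alpha t + a] give [E (alpha t)].  Since
    the maximal mark is attained only once, two simple roots are orthogonal or
    have product -1 ([neighbour_product]), and the diagram is connected
    ([simple_roots_connected]), whence [E x] is in [tilde W] for all [x] in the
    lattice of the simple roots; for [x = b] this is the element [E (a (x) b)].
    A descent on the height ([simple_reflection_ind]) shows that every
    non-negative combination of simple roots of norm 2 is conjugate to a simple
    root, and every root is up to sign such a combination plus an integral
    multiple of [a]; so all reflections in roots lift to [tilde W], and the
    restriction to [V] is onto [W].  That it stays within [W] is the statement
    that [alpha t + a] is a root ([shifted_root]).  The positivity behind all
    this comes from the marks: the form of the simple roots is a sum of squares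
    weighted by their negated products ([marked_form_ge0]).

    Kernel and non-splitting.  An element of [tilde W] that is trivial on [V] is
    determined by the image of [b'].  As [tilde W] preserves the form and the
    lattice spanned by the roots and [b'], this image is [b' - k a] with [k] an
    integer, and the element is the [k]-th power of [E (a (x) b)].  There is no
    section, because [E (alpha 0)] and the translation
    [s_(alpha 0) s_(b - alpha 0)] commute on [V] but not on [b']: commutators of
    lifts in a central extension do not depend on the lifts.

    The second cover.  [hat W] restricts onto [tilde W]; an isometry of [hat V]
    trivial on [tilde V] moves [a'] by a multiple of [a], and by none since [a']
    stays isotropic ([isometry_fixing_tilde]).  So the restriction is an
    isomorphism. *)

(** * Subgroups and central extensions *)

Section GeneratedSubgroups.
Variable G : groupType.
Implicit Types A E N : set G.

Lemma generated_subgroup A : subgroup (generated A).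
Proof.
split=> [B [[B1 _ _] _] //|x y Ax Ay B sAB|x Ax B sAB].
  by have [[_ BM _] _] := sAB; apply: BM; [exact: Ax | exact: Ay].
by have [[_ _ BV] _] := sAB; apply: BV; exact: Ax.
Qed.

Lemma subgroup_centralizer (x : G) : subgroup [set y : G | commute x y].
Proof.
split=> [|y z|y]; rewrite /= /commute; first by rewrite mulg1 mul1g.
  by move=> xy xz; rewrite mulgA xy -!mulgA xz.
by move=> xy; apply: (mulgI y); rewrite mulgA -xy mulgK mulgA mulgV mul1g.
Qed.

Lemma generated_cyclic (h : int -> G) :
  (forall i k, h (i + k) = (h i * h k)%g) -> generated [set h 1] = range h.
Proof.
move=> hD; have h0 : h 0 = 1%g by apply: (mulgI (h 0)); rewrite -hD addr0 mulg1.
have hN i : h (- i) = (h i)^-1%g.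
  by apply: (mulgI (h i)); rewrite -hD subrr h0 mulgV.
apply/seteqP; split=> [|_ [k _ <-]].
  apply: smallest_sub => [|_ ->]; last by exists 1.
  split; first by exists 0.
    by move=> _ _ [i _ <-] [k _ <-]; exists (i + k); rewrite ?hD.
  by move=> _ [i _ <-]; exists (- i); rewrite ?hN.
have [g1 gM gV] := generated_subgroup [set h 1].
have gh1 : generated [set h 1] (h 1) by exact: sub_gen_smallest.
elim/int_rect: k => [|k IH|k IH]; first by rewrite h0.
  by rewrite intS hD; exact: gM.
by rewrite intS opprD hD; apply: gM; rewrite // hN; exact: gV.
Qed.

End GeneratedSubgroups.

Section Extensions.
Variables G H : groupType.

Lemma hom_on1 (E : set G) (phi : G -> H) :
  subgroup E -> hom_on E phi -> phi 1%g = 1%g.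
Proof.
move=> [E1 _ _] phiM; apply: (mulgI (phi 1%g)).
by rewrite -phiM // !mulg1.
Qed.

(** A section is unique up to central factors, and these do not affect
    commutators: so a section would carry the commutation of two images back to
    the given lifts. *)
Lemma noncommuting_lifts_nonsplit (E : set G) (Q : set H) (N : set G)
    (phi : G -> H) x y :
  subgroup E -> central_extension E Q N phi -> E x -> E y ->
  commute (phi x) (phi y) -> ~ commute x y -> ~ split_extension E Q phi.
Proof.
move=> sE [phiM phiE kerN Ncent] Ex Ey cphi ncxy [s [sM sE' phiK]].
have [E1 EM EV] := sE.
have Q_ u : E u -> Q (phi u) by move=> Eu; rewrite -phiE; exists u.
have lift u : E u -> exists2 c, N c & s (phi u) = (u * c)%g.
  move=> Eu; exists (u^-1 * s (phi u))%g; last by rewrite mulgA mulgV mul1g.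
  have Es := sE' _ (Q_ _ Eu).
  rewrite -kerN; split; first by apply: EM => //; exact: EV.
  rewrite /= phiM //; last exact: EV.
  rewrite phiK; last exact: Q_.
  by rewrite -phiM ?mulVg //; [exact: hom_on1 phiM | exact: EV].
have [c Nc sx] := lift _ Ex; have [d Nd sy] := lift _ Ey.
have NE u : N u -> E u by rewrite -kerN => -[].
have : (s (phi x) * s (phi y) = s (phi y) * s (phi x))%g.
  rewrite -!sM; [by rewrite cphi | exact: Q_..].
rewrite sx sy => eqs; apply: ncxy.
have cy := Ncent _ _ Nc Ey; have dx := Ncent _ _ Nd Ex.
have cd := Ncent _ _ Nc (NE _ Nd).
rewrite /commute in cy dx cd *.
apply: (mulIg (c * d)%g); move: eqs.
rewrite -!mulgA ![(c * (_ * _))%g]mulgA cy ![(d * (_ * _))%g]mulgA dx.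
by rewrite -!mulgA cd.
Qed.

End Extensions.

Lemma isomorphic_inv (G H : groupType) (A : set G) (B : set H) (r : H -> G) :
  subgroup B -> hom_on B r -> r @` B = A ->
  (forall h, B h -> r h = 1%g -> h = 1%g) -> isomorphic A B.
Proof.
move=> [B1 BM BV] rM rB r_ker.
have r1 : r 1%g = 1%g by exact: (hom_on1 (And3 B1 BM BV) rM).
have r_inj h k : B h -> B k -> r h = r k -> h = k.
  move=> Bh Bk eq_r; apply: (mulgI k^-1%g); rewrite mulVg.
  apply: r_ker; first by apply: BM => //; exact: BV.
  by rewrite rM // ?eq_r -?rM ?mulVg //; exact: BV.
have [s sP] : exists s : G -> H, forall g, A g -> B (s g) /\ r (s g) = g.
  have ex g : exists h, A g -> B h /\ r h = g.
    have [Ag|nAg] := pselect (A g); last by exists 1%g.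
    by move: Ag; rewrite -rB => -[h Bh <-]; exists h.
  by exists (fun g => projT1 (cid (ex g))) => g; exact: (projT2 (cid (ex g))).
have AM g k : A g -> A k -> A (g * k)%g.
  rewrite -rB => -[x Bx <-] [y By <-]; exists (x * y)%g; last exact: rM.
  exact: BM.
exists s => [g k Ag Ak|].
  have [[Bg rg] [Bk rk]] := (sP _ Ag, sP _ Ak).
  have [Bgk rgk] := sP _ (AM _ _ Ag Ak).
  apply: r_inj => //; first exact: BM.
  by rewrite rM // rg rk.
split=> [g /sP[] //|g k /set_mem/sP[_ rg] /set_mem/sP[_ rk] eq_s|h Bh].
  by rewrite -rg eq_s.
have Ah : A (r h) by rewrite -rB; exists h.
by exists (r h) => //; have [? ?] := sP _ Ah; apply: r_inj.
Qed.

(** * Reflections and restriction *)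

Section Coordinates.
Import VectorInternalTheory.
Variables (K : fieldType) (V : vectType K).
Implicit Types (u v : V).

Lemma vector_eq u v : (forall i, v2r u 0 i = v2r v 0 i) -> u = v.
Proof. by move=> uv; apply: v2r_inj; apply/rowP. Qed.

Lemma v2r_add u v i : v2r (u + v) 0 i = v2r u 0 i + v2r v 0 i.
Proof. by rewrite linearD mxE. Qed.

Lemma v2r_opp u i : v2r (- u) 0 i = - v2r u 0 i.
Proof. by rewrite linearN mxE. Qed.

Lemma v2r_scale c u i : v2r (c *: u) 0 i = c * v2r u 0 i.
Proof. by rewrite linearZ mxE. Qed.

Lemma v2r_zero i : v2r (0 : V) 0 i = 0.
Proof. by rewrite linear0 mxE. Qed.

Definition v2rE := (v2r_add, v2r_opp, v2r_scale, v2r_zero).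

End Coordinates.

(** Linear identities between vectors reduce to ring identities between their
    coordinates. *)
Ltac vector_ring := apply: vector_eq => ?; rewrite !v2rE; ring.

Section Reflections.
Variables (R : realType) (V : vectType R) (f : {symmetric V}).
Implicit Types (x y v : V) (g h : GL V) (A : set V).

Lemma symfC x y : f x y = f y x.
Proof. by rewrite hermC expr0 mul1r. Qed.

Lemma symfDl x y v : f (x + y) v = f x v + f y v.
Proof. exact: linearDl. Qed.

Lemma symfNl x v : f (- x) v = - f x v.
Proof. exact: linearNl. Qed.

Lemma symfZl c x v : f (c *: x) v = c * f x v.
Proof. exact: linearZl_LR. Qed.

Lemma symfDr x y v : f v (x + y) = f v x + f v y.
Proof. by rewrite symfC symfDl !(symfC v). Qed.

Lemma symfNr x v : f v (- x) = - f v x.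
Proof. by rewrite symfC symfNl (symfC v). Qed.

Lemma symfZr c x v : f v (c *: x) = c * f v x.
Proof. by rewrite symfC symfZl (symfC v). Qed.

Lemma symf_suml (I : Type) (r : seq I) (P : pred I) (x : I -> V) v :
  f (\sum_(i <- r | P i) x i) v = \sum_(i <- r | P i) f (x i) v.
Proof. exact: linear_sumlz. Qed.

Lemma symf_sumr (I : Type) (r : seq I) (P : pred I) (x : I -> V) v :
  f v (\sum_(i <- r | P i) x i) = \sum_(i <- r | P i) f v (x i).
Proof. by rewrite symfC symf_suml; apply: eq_bigr => i _; rewrite symfC. Qed.

(* Unlike the generic lemmas on bilinear maps, these keep [f] in its original
   form, so that they can be mixed with hypotheses about [f]. *)
Definition symfE := (symfDl, symfNl, symfZl, symfDr, symfNr, symfZr).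

Lemma refl_norm2 x v : f x x = 2 -> refl f x v = v - f x v *: x.
Proof. by move=> x2; rewrite /refl x2 mulrAC divff ?mul1r // pnatr_eq0. Qed.

Lemma reflK x : f x x = 2 -> involutive (refl f x).
Proof.
by move=> x2 v; rewrite !refl_norm2 // !symfE x2; vector_ring.
Qed.

Lemma refl_isometry x u v : f x x = 2 -> f (refl f x u) (refl f x v) = f u v.
Proof. by move=> x2; rewrite !refl_norm2 // !symfE x2 (symfC u x); ring. Qed.

Lemma reflN x : f x x = 2 -> refl f (- x) =1 refl f x.
Proof.
move=> x2 v; rewrite !refl_norm2 ?symfE ?x2 ?opprK //.
by vector_ring.
Qed.

Lemma GL_eq g h : g =1 h -> g = h.
Proof. by move=> gh; apply: val_inj; apply/lfunP. Qed.

Lemma GL_mulE g h v : (g * h)%g v = g (h v).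
Proof. by rewrite /= lfunE. Qed.

Lemma GL_oneE v : (1%g : GL V) v = v.
Proof. by rewrite /= lfunE. Qed.

Lemma GL_KV g : cancel g (g^-1)%g.
Proof. by move=> v; rewrite -GL_mulE mulVg GL_oneE. Qed.

Lemma GL_VK g : cancel (g^-1)%g g.
Proof. by move=> v; rewrite -GL_mulE mulgV GL_oneE. Qed.

Lemma weyl_group_isometry A g : (forall x, A x -> f x x = 2) ->
  weyl_group f A g -> forall u v, f (g u) (g v) = f u v.
Proof.
move=> A2; move: g; apply: smallest_sub => [|g [x Ax gE] u v].
  split=> [u v|g h gI hI u v|g gI u v]; first by rewrite !GL_oneE.
    by rewrite !GL_mulE gI.
  by rewrite -{2}[u](GL_VK g) -{2}[v](GL_VK g) gI.
by rewrite !gE refl_isometry ?A2.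
Qed.

(** Stated as an equivalence so that it passes to inverses. *)
Lemma weyl_group_stable A (L : set V) g : (forall x, A x -> f x x = 2) ->
  (forall x v, A x -> L v -> L (refl f x v)) ->
  weyl_group f A g -> forall v, L (g v) <-> L v.
Proof.
move=> A2 AL; move: g; apply: smallest_sub => [|g [x Ax gE] v].
  split=> [v|g h gL hL v|g gL v]; first by rewrite GL_oneE.
    by rewrite GL_mulE gL hL.
  by rewrite -gL GL_VK.
rewrite gE; split=> [Lv|Lv]; last exact: AL.
by rewrite -(reflK (A2 _ Ax) v); apply: AL.
Qed.

End Reflections.

Section Restriction.
Variables (R : realType) (T T' : vectType R).
Variables (F : {symmetric T}) (F' : {symmetric T'}) (j : {linear T -> T'}).
Variable A : set T.
Hypothesis j_inj : injective j.
Hypothesis j_isometry : forall x y, F' (j x) (j y) = F x y.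
Hypothesis A2 : forall x, A x -> F x x = 2.

Let intertwined (g : GL T) (h : GL T') := forall v, j (g v) = h (j v).

Let intertwined_subgroup W W' : subgroup W -> subgroup W' ->
  subgroup [set h | W' h /\ exists2 g, W g & intertwined g h].
Proof.
move=> [W1 WM WV] [W1' WM' WV']; split=> [|h k [Wh [g Wg gh]]|h [Wh [g Wg gh]]].
- by split=> //; exists 1%g => // v; rewrite !GL_oneE.
- move=> [Wk [l Wl lk]]; split; first exact: WM'.
  by exists (g * l)%g; [exact: WM | move=> v; rewrite !GL_mulE gh lk].
- split; first exact: WV'.
  exists (g^-1)%g; first exact: WV.
  by move=> v; rewrite -{2}[v](GL_VK g) gh GL_KV.
Qed.

Let intertwined_subgroup' W W' : subgroup W -> subgroup W' ->
  subgroup [set g | W g /\ exists2 h, W' h & intertwined g h].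
Proof.
move=> [W1 WM WV] [W1' WM' WV']; split=> [|g k [Wg [h Wh gh]]|g [Wg [h Wh gh]]].
- by split=> //; exists 1%g => // v; rewrite !GL_oneE.
- move=> [Wk [l Wl kl]]; split; first exact: WM.
  by exists (h * l)%g; [exact: WM' | move=> v; rewrite !GL_mulE gh kl].
- split; first exact: WV.
  exists (h^-1)%g; first exact: WV'.
  by move=> v; rewrite -{2}[v](GL_VK g) gh GL_KV.
Qed.

Let refl_intertwined (g : GL T) (h : GL T') x :
  A x -> g =1 refl F x -> h =1 refl F' (j x) ->
  intertwined g h.
Proof.
move=> /A2 x2 gE hE v; rewrite gE hE !refl_norm2 ?j_isometry //.
by rewrite linearB linearZ.
Qed.

(** The reflection in [j x] preserves the image of [j] and induces there the
    reflection in [x].  So every element on one side has a partner on the other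
    that agrees with it along [j], and the one on [T] is unique because [j] is
    injective; the choice of partners is therefore multiplicative. *)
Lemma weyl_group_restriction : exists r : GL T' -> GL T,
  [/\ forall h, weyl_group F' (j @` A) h -> forall v, j (r h v) = h (j v),
      hom_on (weyl_group F' (j @` A)) r
    & r @` weyl_group F' (j @` A) = weyl_group F A].
Proof.
set W' := weyl_group F' _; set W := weyl_group F A.
have sW' : subgroup W' by exact: generated_subgroup.
have sW : subgroup W by exact: generated_subgroup.
have down h : W' h -> exists2 g, W g & intertwined g h.
  move=> Wh; suff [] : W' h /\ exists2 g, W g & intertwined g h by [].
  move: h Wh; apply: smallest_sub; first exact: intertwined_subgroup.
  move=> h [_ [x Ax <-] hE]; split.
    by apply: sub_gen_smallest; exists (j x) => //; exists x.
  have [|g gE] := @reflection_GL R T F x; first by rewrite A2 // pnatr_eq0.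
  exists g; last exact: refl_intertwined gE hE.
  by apply: sub_gen_smallest; exists x.
have up g : W g -> exists2 h, W' h & intertwined g h.
  move=> Wg; suff [] : W g /\ exists2 h, W' h & intertwined g h by [].
  move: g Wg; apply: smallest_sub; first exact: intertwined_subgroup'.
  move=> g [x Ax gE]; split; first by apply: sub_gen_smallest; exists x.
  have [|h hE] := @reflection_GL R T' F' (j x).
    by rewrite j_isometry A2 // pnatr_eq0.
  exists h; last exact: refl_intertwined gE hE.
  by apply: sub_gen_smallest; exists (j x) => //; exists x.
have uniq g k h : intertwined g h -> intertwined k h -> g = k.
  by move=> gh kh; apply: GL_eq => v; apply: j_inj; rewrite gh kh.
have [r rP] : exists r : GL T' -> GL T,
    forall h, W' h -> W (r h) /\ intertwined (r h) h.
  have ex h : exists g, W' h -> W g /\ intertwined g h.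
    have [Wh|nWh] := pselect (W' h); last by exists 1%g.
    by have [g Wg gh] := down _ Wh; exists g.
  by exists (fun h => projT1 (cid (ex h))) => h; exact: (projT2 (cid (ex h))).
have [_ WM' _] := sW'.
exists r; split=> [h /rP[] //|h k Wh Wk|].
  have [_ rhk] := rP _ (WM' _ _ Wh Wk).
  have [[_ rh] [_ rk]] := (rP _ Wh, rP _ Wk).
  by apply: (uniq _ _ _ rhk) => v; rewrite !GL_mulE rh rk.
apply/seteqP; split=> [_ [h /rP[Wrh _] <-] //|g Wg].
have [h Wh gh] := up _ Wg; exists h => //.
by apply: uniq gh; have [] := rP _ Wh.
Qed.

End Restriction.

(** * Simple roots with marks *)

Section MarkedForm.
Variables (R : realFieldType) (I : finType) (A : I -> I -> R) (m c : I -> R).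
Hypothesis A_sym : forall i k, A i k = A k i.
Hypothesis A_le0 : forall i k, i != k -> A i k <= 0.
Hypothesis m_gt0 : forall i, 0 < m i.
Hypothesis A_null : forall i, \sum_k A i k * m k = 0.

Let y i := c i / m i.
Let q := \sum_i \sum_k A i k * (c i * c k).
Let D i k := - (A i k * (m i * m k)) * (y i - y k) ^+ 2.

Let my i : m i * y i = c i.
Proof. by rewrite /y mulrC divfK // gt_eqF. Qed.

Let D_ge0 i k : 0 <= D i k.
Proof.
have [->|ik] := eqVneq i k; first by rewrite /D subrr expr0n /= mulr0.
rewrite /D mulr_ge0 ?sqr_ge0 // oppr_ge0 mulr_le0_ge0 ?A_le0 //.
by rewrite mulr_ge0 // ltW.
Qed.

Let sum_D : \sum_i \sum_k D i k = q + q.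
Proof.
pose E i k := m i * y i ^+ 2 * (A i k * m k).
have E0 : \sum_i \sum_k E i k = 0.
  by rewrite big1 // => i _; rewrite -mulr_sumr A_null mulr0.
have E0' : \sum_i \sum_k E k i = 0 by rewrite exchange_big.
transitivity (q + q - (\sum_i \sum_k E i k + \sum_i \sum_k E k i)).
  rewrite -!big_split -sumrB /=.
  apply: eq_bigr => i _; rewrite -!big_split -sumrB /=.
  by apply: eq_bigr => k _; rewrite /D /E -!my (A_sym k i); ring.
by rewrite E0 E0' addr0 subr0.
Qed.

(** Twice the form is the sum over [i] and [k] of
    [- A i k * m i * m k * (c i / m i - c k / m k) ^+ 2], because the rows of
    [A] annihilate the marks. *)
Lemma marked_form_ge0 : 0 <= q.
Proof.
have : 0 <= q + q by rewrite -sum_D; do 2!apply: sumr_ge0 => ? _.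
by lra.
Qed.

(** All these summands vanish, so [c i / m i = c k / m k] as soon as [A i k] is
    not zero, and each row of [A] annihilates [c] as it does [m]. *)
Lemma marked_form_eq0 : q = 0 -> forall i, \sum_k A i k * c k = 0.
Proof.
move=> q0 i; have D0 k : D i k = 0.
  have /eqP := sum_D; rewrite q0 addr0 psumr_eq0 => [|l _]; last first.
    exact: sumr_ge0.
  move=> /allP/(_ i (mem_index_enum _)) /=; rewrite psumr_eq0 //.
  by move=> /allP/(_ k (mem_index_enum _))/eqP.
transitivity (y i * \sum_k A i k * m k); last by rewrite A_null mulr0.
rewrite mulr_sumr; apply: eq_bigr => k _.
have /eqP := D0 k; rewrite /D mulf_eq0 oppr_eq0 !mulf_eq0.
rewrite (gt_eqF (m_gt0 i)) (gt_eqF (m_gt0 k)) /= orbF.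
rewrite orbb subr_eq0 => /orP[/eqP->|/eqP->]; first by rewrite !mul0r mulr0.
by rewrite -my; ring.
Qed.

End MarkedForm.

Section MarkedRoots.
Variables (R : realType) (T : vectType R) (F : {symmetric T}).
Variables (I : finType) (alpha : I -> T) (m : I -> nat).

Definition int_comb (c : I -> int) : T := \sum_i (c i)%:~R *: alpha i.

(** Simple roots of a simply laced affine diagram with their marks; [int_comb m]
    is the null root.  The last condition, that the null root spans the radical
    of the root lattice, is put on coefficients so that, like the others, it
    depends on the Gram matrix only and carries over along isometries. *)
Record marked_simple_roots : Prop := {
  msr_norm : forall i, F (alpha i) (alpha i) = 2;
  msr_int : forall i k, F (alpha i) (alpha k) \is a Num.int;
  msr_le0 : forall i k, i != k -> F (alpha i) (alpha k) <= 0;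
  msr_gt0 : forall i, (0 < m i)%N;
  msr_null : forall i, F (int_comb m) (alpha i) = 0;
  msr_multiple : forall c, (forall i, F (int_comb c) (alpha i) = 0) ->
    exists k : int, forall i, c i = k * m i
}.

Hypothesis msr : marked_simple_roots.

Lemma int_comb_shift c i p :
  int_comb c + p%:~R *: alpha i = int_comb (fun k => c k + p *+ (k == i)).
Proof.
rewrite /int_comb (bigD1 i) //= [RHS](bigD1 i) //= eqxx mulr1n.
rewrite addrAC -scalerDl -rmorphD /=; congr (_ + _).
by apply: eq_bigr => k /negPf->; rewrite mulr0n addr0.
Qed.

Lemma int_combZ k c : int_comb (fun i => k * c i) = k%:~R *: int_comb c.
Proof.
rewrite /int_comb scaler_sumr; apply: eq_bigr => i _.
by rewrite scalerA -rmorphM.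
Qed.

Lemma form_int_comb c x : F (int_comb c) x = \sum_i (c i)%:~R * F (alpha i) x.
Proof. by rewrite symf_suml; apply: eq_bigr => i _; rewrite symfZl. Qed.

Lemma int_comb_int c i : F (int_comb c) (alpha i) \is a Num.int.
Proof.
rewrite form_int_comb rpred_sum // => k _.
by rewrite rpredM ?(msr_int msr) ?intr_int.
Qed.

Let norm_int_comb c : F (int_comb c) (int_comb c) =
  \sum_i \sum_k F (alpha i) (alpha k) * ((c i)%:~R * (c k)%:~R).
Proof.
rewrite form_int_comb; apply: eq_bigr => i _.
rewrite symfC form_int_comb mulr_sumr.
by apply: eq_bigr => k _; rewrite (symfC F (alpha k)); ring.
Qed.

Let null_row i : \sum_k F (alpha i) (alpha k) * ((m k)%:~R : R) = 0.
Proof.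
transitivity (F (int_comb m) (alpha i)); last exact: msr_null.
rewrite form_int_comb.
by apply: eq_bigr => k _; rewrite mulrC symfC.
Qed.

Let mR_gt0 i : (0 : R) < (m i)%:~R.
Proof. by rewrite ltr0z ltz_nat msr_gt0. Qed.

Lemma int_comb_norm_ge0 c : 0 <= F (int_comb c) (int_comb c).
Proof.
rewrite norm_int_comb.
apply: (@marked_form_ge0 R I (fun i k => F (alpha i) (alpha k))
  (fun i => (m i)%:~R) (fun i => (c i)%:~R)) => // [i k|]; first exact: symfC.
exact: msr_le0.
Qed.

Lemma int_comb_norm_eq0 c : F (int_comb c) (int_comb c) = 0 ->
  exists k : int, forall i, c i = k * m i.
Proof.
rewrite norm_int_comb => q0; apply: (msr_multiple msr) => i.
rewrite form_int_comb.
transitivity (\sum_k F (alpha i) (alpha k) * (c k)%:~R).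
  by apply: eq_bigr => k _; rewrite mulrC symfC.
apply: (@marked_form_eq0 R I (fun i k => F (alpha i) (alpha k))
  (fun i => (m i)%:~R) (fun i => (c i)%:~R)) => // [k l|]; first exact: symfC.
exact: msr_le0.
Qed.

(** Descent on the height: some simple root [alpha i] in the support of [x] has
    positive product [p] with [x], and the reflection in it lowers the
    coefficient of [alpha i] by [p].  Should this coefficient become negative,
    the rest of [x] has norm zero, so is a multiple of the null vector; as it
    misses [alpha i] it vanishes, and [x] is [alpha i]. *)
Lemma simple_reflection_ind (P : T -> Prop) :
  (forall i, P (alpha i)) ->
  (forall i x, P x -> P (refl F (alpha i) x)) ->
  forall c : I -> nat, F (int_comb c) (int_comb c) = 2 -> P (int_comb c).
Proof.
move=> P_simple P_refl c.
have [N leN] := ubnP (\sum_i c i)%N; elim: N c leN => // N IH c leN.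
set x := int_comb c => x2.
have [i ci_gt0 xi_gt0] : exists2 i, (0 < c i)%N & 0 < F x (alpha i).
  apply: contrapT => nex.
  have : F x x <= 0.
    rewrite form_int_comb; apply: sumr_le0 => i _.
    have [-> | ci_gt0] := posnP (c i); first by rewrite mul0r.
    rewrite mulr_ge0_le0 ?ler0z // symfC leNgt; apply/negP => xi.
    by apply: nex; exists i.
  by rewrite x2 lern0.
have [p xip] := intrP (int_comb_int c i); rewrite -/x in xip.
move: xi_gt0; rewrite xip ltr0z => p_gt0.
have rx : refl F (alpha i) x = x + (- p)%:~R *: alpha i.
  by rewrite refl_norm2 ?msr_norm // symfC xip rmorphN scaleNr.
have [le_pc|lt_cp] := leP p (c i).
  rewrite -(reflK (msr_norm msr i) x); apply: P_refl.
  have norm_rx := refl_isometry x x (msr_norm msr i).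
  move: norm_rx; rewrite x2 rx int_comb_shift.
  pose c' k := (c k - `|p| * (k == i))%N.
  have -> : int_comb (fun k => (c k)%:Z + - p *+ (k == i)) = int_comb c'.
    congr int_comb; apply/funext => k; rewrite /c'.
    by have [->|] := eqVneq k i; lia.
  apply: IH; rewrite ltnS in leN; apply: leq_trans leN.
  rewrite (bigD1 i) //= [X in (_ < X)%N](bigD1 i) //=.
  rewrite -addSn leq_add //; first by rewrite /c' eqxx muln1; lia.
  by apply: leq_sum => k _; exact: leq_subr.
have yE := int_comb_shift c i (- (c i)%:Z); rewrite -/x in yE.
set d := (fun k => _) in yE.
have di : d i = 0 by rewrite /d eqxx mulr1n subrr.
have y_norm : F (int_comb d) (int_comb d) =
    2 - 2 * ((c i)%:Z * (p - (c i)%:Z))%:~R.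
  rewrite -yE !symfE x2 (symfC _ (alpha i)) xip msr_norm //.
  rewrite !(rmorphM, rmorphB, rmorphN) /=; ring.
have y_ge0 := int_comb_norm_ge0 d.
have cp_ge1 : 1 <= (c i)%:Z * (p - (c i)%:Z) by nia.
have cp_le1 : (c i)%:Z * (p - (c i)%:Z) <= 1.
  by rewrite -(ler_int R); move: y_ge0; rewrite y_norm; lra.
have cp1 : (c i)%:Z * (p - (c i)%:Z) = 1 by lia.
have [|k dk] := @int_comb_norm_eq0 d.
  by rewrite y_norm cp1 mulr1 subrr.
have k0 : k = 0.
  by have := dk i; have := msr_gt0 msr i; rewrite di; nia.
have y0 : int_comb d = 0.
  by rewrite /int_comb big1 // => l _; rewrite dk k0 mul0r scale0r.
have ci1 : c i = 1%N by nia.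
move: yE; rewrite y0 ci1 => /eqP; rewrite rmorphN scaleNr scale1r subr_eq0.
by move=> /eqP->.
Qed.

Section Connected.
Variable t : I.
Hypothesis t_unique : forall i, m i = m t -> i = t.

(** Positivity of the norm of [alpha i + alpha k] bounds the product below by
    -2.  A product -2 would make [alpha i + alpha k] the null vector: then [i]
    and [k] are the only indices and their marks agree, so that the mark of [t]
    is attained twice. *)
Lemma neighbour_product i k : i != k -> F (alpha i) (alpha k) != 0 ->
  F (alpha i) (alpha k) = -1.
Proof.
move=> ik ik0.
have [p pE] := intrP (msr_int msr i k).
have p_lt0 : p < 0 by rewrite -(ltrz0 R) -pE lt_neqAle ik0 msr_le0.
pose c l : int := 0 + 1 *+ (l == i) + 1 *+ (l == k).
have cE : int_comb c = alpha i + alpha k.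
  rewrite -!int_comb_shift !scale1r /int_comb big1 ?add0r // => l _.
  by rewrite scale0r.
have c_norm : F (int_comb c) (int_comb c) = (4 + 2 * p)%:~R.
  rewrite cE !symfE (symfC F (alpha k)) !(msr_norm msr) pE.
  by rewrite rmorphD rmorphM /=; ring.
have := int_comb_norm_ge0 c; rewrite c_norm ler0z => p_ge.
have [p2|p1] : p = - 2 \/ p = - 1 by lia.
  have [|l cl] := int_comb_norm_eq0 (c := c); first by rewrite c_norm p2.
  have := cl i; have := cl k; have := cl t; have mt := msr_gt0 msr t.
  rewrite /c !eqxx (eq_sym k) (negPf ik).
  have [ti'|nti] := eqVneq t i; have [tk|ntk] := eqVneq t k.
  - by move: ik; rewrite -ti' tk eqxx.
  - rewrite -ti' => _ /= lk lt'; have mk : m k = m t by nia.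
    by move: ntk; rewrite (t_unique mk) eqxx.
  - rewrite -tk => _ /= lk lt'; have mi : m i = m t by nia.
    by move: nti; rewrite (t_unique mi) eqxx.
  - by move=> /= lt' lk li; nia.
by rewrite pE p1.
Qed.

(** As [S] is closed under neighbours, the simple roots in [S] are orthogonal to
    all
    others, so that the part of the null vector supported on [S] is null by
    itself; being a multiple of the whole null vector, it is all of it. *)
Lemma simple_roots_connected (S : I -> Prop) : S t ->
  (forall i k, F (alpha i) (alpha k) = -1 -> S i -> S k) -> forall i, S i.
Proof.
move=> St S_next i.
have S_orth k l : `[< S k >] -> ~~ `[< S l >] -> F (alpha k) (alpha l) = 0.
  move=> /asboolP Sk /asboolP nSl; apply/eqP/negPn/negP => kl.
  apply: (nSl); apply: S_next (Sk); apply: neighbour_product kl.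
  by apply/eqP => kl_eq; apply: nSl; rewrite -kl_eq.
pose c k : int := if `[< S k >] then (m k)%:Z else 0.
have [l|k cE] := msr_multiple msr (c := c).
  rewrite form_int_comb.
  have [Sl|nSl] := boolP `[< S l >].
    transitivity (F (int_comb m) (alpha l)); last exact: msr_null.
    rewrite form_int_comb; apply: eq_bigr => k _; rewrite /c.
    by case: (boolP `[< S k >]) => // nSk; rewrite symfC (S_orth l k) // !mulr0.
  rewrite big1 // => k _; rewrite /c.
  case: (boolP `[< S k >]) => [Sk|_]; last by rewrite mul0r.
  by rewrite S_orth ?mulr0.
have mt := msr_gt0 msr t; have mi := msr_gt0 msr i.
have := cE t; rewrite {1}/c asboolT // => kt; have k1 : k = 1 by nia.
apply/asboolP; have := cE i; rewrite /c; case: `[< S i >] => // ci.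
by exfalso; nia.
Qed.

(** An isolated simple root would have product 2 * m i with the null vector. *)
Lemma simple_root_neighbour i : exists k, F (alpha i) (alpha k) = -1.
Proof.
apply: contrapT => no_nb; have := msr_null msr i.
rewrite form_int_comb (bigD1 i) //= big1 => [|k ki].
  move=> /eqP; rewrite addr0 msr_norm // mulf_eq0 intr_eq0 pnatr_eq0 orbF.
  by have := msr_gt0 msr i; lia.
have [->|ik0] := eqVneq (F (alpha k) (alpha i)) 0; first by rewrite mulr0.
by case: no_nb; exists k; rewrite symfC neighbour_product.
Qed.

End Connected.

End MarkedRoots.

(** * Transvections along an isotropic vector *)

Section Transvections.
Variables (R : realType) (T : vectType R) (F : {symmetric T}).
Variables (a : T) (G : set (GL T)).
Hypothesis a_null : forall v, F a v = 0.
Hypothesis sG : subgroup G.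

Definition reflected (x : T) := exists2 g, G g & g =1 refl F x.
(** The map is the Eichler-Siegel transvection [E (a (x) x)]. *)
Definition transvected (x : T) :=
  exists2 g, G g & forall v, g v = v - F x v *: a.

Let a_null' v : F v a = 0. Proof. by rewrite symfC. Qed.

Let refl_inv (g : GL T) x : F x x = 2 -> g =1 refl F x -> (g^-1)%g =1 refl F x.
Proof. by move=> x2 gE v; rewrite -{1}[v](reflK x2) -gE GL_KV. Qed.

Lemma reflected_opp x : F x x = 2 -> reflected x -> reflected (- x).
Proof. by move=> x2 [g Gg gE]; exists g => // v; rewrite reflN. Qed.

Lemma reflected_refl x y : F x x = 2 -> F y y = 2 ->
  reflected x -> reflected y -> reflected (refl F x y).
Proof.
move=> x2 y2 [g Gg gE] [h Gh hE]; have [_ GM GV] := sG.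
exists (g * h * g^-1)%g; first by apply: (GM); [exact: GM | exact: GV].
move=> v; rewrite !GL_mulE (refl_inv x2 gE) gE hE.
have xy2 : F (refl F x y) (refl F x y) = 2 by rewrite refl_isometry.
rewrite (refl_norm2 _ xy2) (refl_norm2 _ y2) !(refl_norm2 _ x2).
by rewrite !symfE x2 (symfC F y x); vector_ring.
Qed.

Lemma transvected_refl x y : F x x = 2 ->
  reflected x -> transvected y -> transvected (refl F x y).
Proof.
move=> x2 [g Gg gE] [h Gh hE]; have [_ GM GV] := sG.
exists (g * h * g^-1)%g; first by apply: (GM); [exact: GM | exact: GV].
move=> v; rewrite !GL_mulE (refl_inv x2 gE) gE hE.
by rewrite !(refl_norm2 _ x2) !symfE x2 a_null' (symfC F y x); vector_ring.
Qed.

Lemma transvected0 : transvected 0.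
Proof.
have [G1 _ _] := sG; exists 1%g => // v.
by rewrite GL_oneE -(scale0r v) symfZl mul0r scale0r subr0.
Qed.

Lemma transvected_add x y :
  transvected x -> transvected y -> transvected (x + y).
Proof.
move=> [g Gg gE] [h Gh hE]; have [_ GM _] := sG.
exists (g * h)%g; first exact: GM.
by move=> v; rewrite GL_mulE hE gE !symfE a_null'; vector_ring.
Qed.

Lemma transvected_opp x : transvected x -> transvected (- x).
Proof.
move=> [g Gg gE]; have [_ _ GV] := sG.
exists (g^-1)%g; first exact: GV.
move=> v; rewrite -{2 3}[v](GL_VK g) gE !symfE a_null'; vector_ring.
Qed.

Lemma transvectedZ x (k : int) : transvected x -> transvected (k%:~R *: x).
Proof.
move=> tx; elim/int_rect: k => [|k IH|k IH].
  by rewrite scale0r; exact: transvected0.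
  by rewrite intS rmorphD scalerDl scale1r; exact: transvected_add.
rewrite intS opprD rmorphD scalerDl rmorphN scaleN1r.
by apply: transvected_add => //; exact: transvected_opp.
Qed.

(** The transvection is [s_x s_(x+a)]. *)
Lemma transvected_of_reflected x : F x x = 2 ->
  reflected x -> reflected (x + a) -> transvected x.
Proof.
move=> x2 [g Gg gE] [h Gh hE]; have [_ GM _] := sG.
exists (g * h)%g; first exact: GM.
have xa2 : F (x + a) (x + a) = 2 by rewrite !symfE x2 !a_null !a_null' !addr0.
move=> v; rewrite GL_mulE gE hE (refl_norm2 _ xa2) !(refl_norm2 _ x2).
rewrite !symfE x2 !a_null !a_null'.
by vector_ring.
Qed.

(** Conversely [s_(x+ka)] is the transvection along [-k x] times [s_x]. *)
Lemma reflected_shift x (k : int) : F x x = 2 ->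
  reflected x -> transvected x -> reflected (x + k%:~R *: a).
Proof.
move=> x2 [g Gg gE] tx; have [_ GM _] := sG.
have [h Gh hE] := transvectedZ (- k) tx.
have xk2 : F (x + k%:~R *: a) (x + k%:~R *: a) = 2.
  by rewrite !symfE x2 !a_null !a_null'; ring.
exists (h * g)%g; first exact: GM.
move=> v; rewrite GL_mulE hE gE (refl_norm2 _ xk2) (refl_norm2 _ x2).
rewrite !symfE x2 a_null rmorphN.
by vector_ring.
Qed.

Section Propagation.
Variables (I : finType) (alpha : I -> T) (m : I -> nat) (t : I).
Hypothesis msr : marked_simple_roots F alpha m.
Hypothesis t_unique : forall i, m i = m t -> i = t.
Hypothesis alpha_reflected : forall i, reflected (alpha i).

(** If [alpha k] is a neighbour of [alpha i], the reflection in [alpha k] takes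
    [alpha i] to [alpha i + alpha k]; so the property passes to neighbours. *)
Lemma transvected_simple :
  transvected (alpha t) -> forall i, transvected (alpha i).
Proof.
move=> tt; apply: (simple_roots_connected msr t_unique) => // i k ik ti.
have -> : alpha k = refl F (alpha k) (alpha i) + - alpha i.
  by rewrite refl_norm2 ?(msr_norm msr) // symfC ik; vector_ring.
apply: transvected_add; last exact: transvected_opp.
by apply: transvected_refl => //; rewrite (msr_norm msr).
Qed.

Lemma transvected_int_comb c :
  transvected (alpha t) -> transvected (int_comb alpha c).
Proof.
move=> /transvected_simple tr.
apply: (big_ind transvected) => [|x y|i _]; first exact: transvected0.
  exact: transvected_add.
exact: transvectedZ.
Qed.

Lemma reflected_int_comb (c : I -> nat) :
  F (int_comb alpha c) (int_comb alpha c) = 2 -> reflected (int_comb alpha c).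
Proof.
move=> c2; suff [] : F (int_comb alpha c) (int_comb alpha c) = 2 /\
  reflected (int_comb alpha c) by [].
move: c2; apply: (simple_reflection_ind msr
  (P := fun x => F x x = 2 /\ reflected x)) => [i|i x [x2 rx]].
  by rewrite (msr_norm msr).
split; first by rewrite refl_isometry ?(msr_norm msr).
by apply: reflected_refl; rewrite ?(msr_norm msr).
Qed.

End Propagation.

End Transvections.

(** * Elliptic roots *)

Section IntegerSpan.
Variables (R : realType) (V : vectType R).
Implicit Types (A : set V) (x y : V).

Lemma zspan_mem A x : A x -> zspan A x.
Proof.
move=> Ax; exists [:: (1, x)]; first by move=> p; rewrite inE => /eqP->.
by rewrite big_seq1.
Qed.

Lemma zspan_add A x y : zspan A x -> zspan A y -> zspan A (x + y).
Proof.
move=> [s sA ->] [u uA ->]; exists (s ++ u); last by rewrite big_cat.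
by move=> p; rewrite mem_cat => /orP[/sA|/uA].
Qed.

Lemma zspanZ A (k : int) x : zspan A x -> zspan A (k%:~R *: x).
Proof.
move=> [s sA ->]; exists [seq (k * p.1, p.2) | p <- s].
  by move=> _ /mapP[p /sA ? ->].
rewrite big_map scaler_sumr; apply: eq_bigr => p _ /=.
by rewrite scaler_int -mulrzA mulrC.
Qed.

Lemma zspan_ind A (P : V -> Prop) : P 0 ->
  (forall x y, P x -> P y -> P (x + y)) ->
  (forall (k : int) x, A x -> P (k%:~R *: x)) -> forall x, zspan A x -> P x.
Proof.
move=> P0 PD PZ x [s sA ->]; elim: s sA => [|p s IH] sA.
  by rewrite big_nil.
rewrite big_cons -scaler_int; apply: PD; first by apply/PZ/sA; rewrite mem_head.
by apply: IH => q qs; apply: sA; rewrite inE qs orbT.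
Qed.

Lemma zspan_set1 x y : zspan [set x] y <-> exists k : int, y = k%:~R *: x.
Proof.
split=> [|[k ->]]; last by apply/zspanZ/zspan_mem.
move: y; apply: (zspan_ind (P := fun y => exists k : int, y = k%:~R *: x)).
- by exists 0; rewrite scale0r.
- by move=> u v [k ->] [l ->]; exists (k + l); rewrite rmorphD scalerDl.
- by move=> k _ ->; exists k.
Qed.

Lemma zspan_int_comb A (I : finType) (alpha : I -> V) c :
  (forall i, A (alpha i)) -> zspan A (int_comb alpha c).
Proof.
move=> Aalpha; apply: (big_ind (zspan A)) => [|x y|i _].
- by exists [::]; rewrite ?big_nil.
- exact: zspan_add.
- exact/zspanZ/zspan_mem.
Qed.

Lemma free_codom (I : finType) (beta : I -> V) (c : I -> R) :
  free (codom beta) -> \sum_i c i *: beta i = 0 -> forall i, c i = 0.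
Proof.
move=> fr_b sum0 i; have /freeP fr : free (codom_tuple beta) by [].
have := fr (fun k => c (enum_val k)) _ (enum_rank i).
rewrite enum_rankK; apply; rewrite -[RHS]sum0.
rewrite (reindex (@enum_rank I)); last exact/onW_bij/enum_rank_bij.
by apply: eq_bigr => k _; rewrite nth_codom enum_rankK.
Qed.

End IntegerSpan.

Section EllipticRoots.
Variables (R : realType) (n : nat) (V : vectType R) (f : {symmetric V}).
Variables (Phi : set V) (U : {vspace V}) (a : V).
Variables (VU : vectType R) (fU : {symmetric VU}) (pi : 'Hom(V, VU)).
Variables (beta : 'I_n.+1 -> VU) (m : 'I_n.+1 -> nat) (alpha : 'I_n.+1 -> V).
Hypothesis grs : generalized_root_system f fullv Phi.
Hypothesis norm2 : forall x, Phi x -> f x x = 2.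
Hypothesis mark : marking f Phi U a.
Hypothesis quot : quotient_space f U fU pi.
Hypothesis arb : affine_root_basis f fU pi Phi beta m.
Hypothesis lifts : forall i, Phi (alpha i) /\ pi (alpha i) = beta i.

Let Phi_alpha i : Phi (alpha i). Proof. by have [] := lifts i. Qed.

Let pi_int_comb c : pi (int_comb alpha c) = int_comb beta c.
Proof.
rewrite linear_sum; apply: eq_bigr => i _.
by rewrite linearZ /=; have [_ ->] := lifts i.
Qed.

Let beta_free (c : 'I_n.+1 -> int) (d : 'I_n.+1 -> int) :
  int_comb beta c = int_comb beta d -> c =1 d.
Proof.
move=> eq_cd i; have [_ fr _] := arb_basis arb.
apply/eqP; rewrite -subr_eq0 -(intr_eq0 R); apply/eqP; move: i.
apply: free_codom fr _.
transitivity (int_comb beta c - int_comb beta d); last by rewrite eq_cd subrr.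
rewrite /int_comb -sumrB; apply: eq_bigr => i _.
by rewrite rmorphB scalerBl.
Qed.

Let markingE x : zspan Phi x /\ x \in U <-> exists k : int, x = k%:~R *: a.
Proof.
rewrite -zspan_set1 -(mark_gen mark); split=> [[]//|[]//].
Qed.

Lemma marking_zspan : zspan Phi a.
Proof. by have [_ []] := markingE a; first by exists 1; rewrite scale1r. Qed.

Let aU : a \in U.
Proof. by have [_ []] := markingE a; first by exists 1; rewrite scale1r. Qed.

Let pi_a : pi a = 0.
Proof. by apply/eqP; rewrite -memv_ker; have [-> _ _] := quot. Qed.

Let null_radical x : x \in orthov f fullv -> forall y, f x y = 0.
Proof. by move=> /mem_orthovP xo y; apply: xo; rewrite memvf. Qed.

Lemma marking_null y : f a y = 0.
Proof. by apply: null_radical; apply: (subvP (mark_radical mark)). Qed.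

Lemma marking_neq0 : a != 0.
Proof.
have [v v0 /markingE[k vE]] := mark_lattice mark.
by apply: contra_neq v0 => a0; rewrite vE a0 scaler0.
Qed.

Let pi_eq0 x : zspan Phi x -> pi x = 0 -> exists k : int, x = k%:~R *: a.
Proof.
move=> Lx pix; apply/markingE; split=> //.
by have [<- _ _] := quot; rewrite memv_ker pix.
Qed.

Lemma root_decomposition x : Phi x -> exists (c : 'I_n.+1 -> nat) (k : int),
  x = int_comb alpha c + k%:~R *: a \/ x = - int_comb alpha c + k%:~R *: a.
Proof.
move=> Phix; have [_ _ dec] := arb_basis arb.
have [|c pix] := dec (pi x); first by exists x.
have combE : \sum_i beta i *+ c i = pi (int_comb alpha c).
  by rewrite pi_int_comb; apply: eq_bigr => i _; rewrite scaler_int.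
have Lx := zspan_mem Phix; have Lc : zspan Phi (int_comb alpha c).
  exact: zspan_int_comb.
exists c; case: pix => pix.
- have [||k xk] := @pi_eq0 (x - int_comb alpha c).
  + by rewrite -scaleN1r -(rmorphN1 intr); apply: zspan_add => //;
      exact: zspanZ.
  + by rewrite linearB /= pix combE subrr.
  by exists k; left; rewrite -xk addrC subrK.
- have [||k xk] := @pi_eq0 (x + int_comb alpha c).
  + exact: zspan_add.
  + by rewrite linearD /= pix combE addNr.
  by exists k; right; rewrite -xk addrC addrK.
Qed.

Let null_of_simple x :
  (forall i, f x (alpha i) = 0) -> forall y, f x y = 0.
Proof.
move=> x_simple y.
have x_comb c : f x (int_comb alpha c) = 0.
  by rewrite symf_sumr big1 // => i _; rewrite symfZr x_simple mulr0.
have x_Phi z : Phi z -> f x z = 0.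
  move=> /root_decomposition[c [k [->|->]]].
    by rewrite !symfE x_comb symfC marking_null mulr0 addr0.
  by rewrite !symfE x_comb symfC marking_null mulr0 addr0 oppr0.
have : rspan Phi y by rewrite (grs_span grs) /= memvf.
move=> [s sPhi /(coord_span (X := in_tuple s))->].
rewrite symf_sumr big1 // => i _; rewrite symfZr x_Phi ?mulr0 //.
by apply: sPhi; rewrite mem_nth.
Qed.

(** Modulo the marking the null vectors of the root lattice are the multiples of
    the null root, and in the marking they are the multiples of [a]. *)
Lemma null_lattice x : zspan Phi x -> (forall y, f x y = 0) ->
  exists k l : int, x = k%:~R *: int_comb alpha m + l%:~R *: a.
Proof.
move=> Lx x_null.
have [k pix] : exists k : int, pi x = k%:~R *: int_comb beta m.
  suff : zspan [set \sum_i beta i *+ m i] (pi x).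
    move=> /zspan_set1[k ->]; exists k; congr (_ *: _).
    by apply: eq_bigr => i _; rewrite scaler_int.
  rewrite -(arb_marks arb); split.
    move: Lx; elim/zspan_ind => [|u v|k u Phiu];
      rewrite ?linear0 ?linearD ?linearZ.
    - by exists [::]; rewrite ?big_nil.
    - exact: zspan_add.
    - by apply/zspanZ/zspan_mem; exists u.
  by rewrite /= memv_img //; apply/mem_orthovP => y _; exact: x_null.
have [||l xl] := @pi_eq0 (x + (- k)%:~R *: int_comb alpha m).
- by apply: zspan_add => //; apply/zspanZ/zspan_int_comb.
- by rewrite linearD linearZ /= pix pi_int_comb rmorphN scaleNr subrr.
by exists k, l; rewrite -xl rmorphN scaleNr addrC subrK.
Qed.

(** The marks only make the image of the combination agree with that of some
    radical vector; the difference of the two lies in the marking, which is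
    radical as well. *)
Lemma null_combination_null y : f (int_comb alpha m) y = 0.
Proof.
have : (zspan [set \sum_i beta i *+ m i]) (int_comb beta m).
  apply: zspan_mem; apply: eq_bigr => i _; exact: scaler_int.
rewrite -(arb_marks arb) => -[_ /memv_imgP[r /null_radical r_null pir]].
have : int_comb alpha m - r \in U.
  by have [<- _ _] := quot; rewrite memv_ker linearB /= pi_int_comb pir subrr.
move=> /(subvP (mark_radical mark))/null_radical/(_ y).
by rewrite !symfE r_null oppr0 addr0.
Qed.

Lemma root_form_int x y : Phi x -> Phi y -> f x y \is a Num.int.
Proof.
move=> Phix Phiy; have := grs_int grs Phix Phiy.
by rewrite norm2 // mulrAC divff ?mul1r // pnatr_eq0.
Qed.

Let root_sign d : Phi (int_comb alpha d) ->
  (forall i, 0 <= d i) \/ (forall i, d i <= 0).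
Proof.
move=> Phid; have [_ _ dec] := arb_basis arb.
have [|c] := dec (int_comb beta d).
  by rewrite -pi_int_comb; exists (int_comb alpha d).
have -> : \sum_i beta i *+ c i = int_comb beta c.
  by apply: eq_bigr => l _; rewrite scaler_int.
rewrite -scaleN1r -(rmorphN1 intr) -int_combZ => -[] /beta_free dc.
- by left=> i; rewrite dc.
- by right=> i; rewrite dc mulN1r oppr_le0.
Qed.

(** Two distinct simple roots have non-positive product [p], as the reflection
    [alpha k - p alpha i] is a root with coefficient 1 at [alpha k], so that
    [- p] is non-negative. *)
Lemma simple_roots_marked : marked_simple_roots f alpha m.
Proof.
split=> [i|i k|i k ik|i|i|c c_null].
- exact: norm2.
- exact: root_form_int.
- have [p pE] := intrP (root_form_int (Phi_alpha i) (Phi_alpha k)).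
  have := grs_refl grs (Phi_alpha i) (Phi_alpha k).
  have -> : refl f (alpha i) (alpha k) =
      int_comb alpha (fun l => 0 + 1 *+ (l == k) + (- p) *+ (l == i)).
    rewrite -!int_comb_shift /int_comb big1 => [|l _]; last by rewrite scale0r.
    by rewrite refl_norm2 ?norm2 // pE add0r scale1r rmorphN scaleNr.
  have k1 : (0 + 1 *+ (k == k) + (- p) *+ (k == i) : int) = 1.
    by rewrite eqxx eq_sym (negPf ik).
  rewrite pE lerz0 => /root_sign[/(_ i)|/(_ k)]; last by rewrite k1.
  by rewrite (negPf ik) eqxx; lia.
- exact: arb_mark_gt0 arb i.
- exact: null_combination_null.
have [||k [l cE]] := @null_lattice (int_comb alpha c).
- exact: zspan_int_comb.
- exact: null_of_simple.
exists k; apply: beta_free; rewrite int_combZ -!pi_int_comb cE.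
by rewrite linearD !linearZ /= pi_a scaler0 addr0.
Qed.

Lemma root_positive_part x : Phi x -> exists (c : 'I_n.+1 -> nat) (k : int),
  f (int_comb alpha c) (int_comb alpha c) = 2 /\
  (x = int_comb alpha c + k%:~R *: a \/ x = - (int_comb alpha c + k%:~R *: a)).
Proof.
move=> Phix; have x2 := norm2 Phix.
have [c [k xE]] := root_decomposition Phix; exists c.
have nE l (y : V) : f (y + l *: a) (y + l *: a) = f y y.
  by rewrite !symfE !marking_null (symfC f y) marking_null; ring.
case: xE => xE; move: x2; rewrite xE nE ?symfE ?opprK => c2.
  by exists k; split=> //; left.
exists (- k); split=> //; right.
by rewrite opprD rmorphN scaleNr opprK.
Qed.

Section Shift.
Variable t : 'I_n.+1.
Hypothesis t_unique : forall i, m i = m t -> i = t.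

Let msr := simple_roots_marked.

Let reflE i x : refl f (alpha i) x = x - f (alpha i) x *: alpha i.
Proof. by rewrite refl_norm2 // norm2. Qed.

Let Phi_refl i x : Phi x -> Phi (x - f (alpha i) x *: alpha i).
Proof. by move=> Phix; rewrite -reflE; apply: (grs_refl grs). Qed.

Let Phi_eq x y : Phi x -> x = y -> Phi y. Proof. by move=> ? <-. Qed.

Let Phi_opp x : Phi x -> Phi (- x).
Proof.
move=> Phix; apply: Phi_eq (grs_refl grs Phix Phix) _.
by rewrite (refl_norm2 _ (norm2 Phix)) (norm2 Phix); vector_ring.
Qed.

Let shift (k : int) x := x + k%:~R *: a.

Let a_null x : f x a = 0. Proof. by rewrite symfC marking_null. Qed.

Let Phi_shift_refl k i x :
  Phi (shift k x) -> Phi (shift k (refl f (alpha i) x)).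
Proof.
move=> /(Phi_refl i)/Phi_eq; apply.
by rewrite reflE /shift !symfE a_null; vector_ring.
Qed.

Let shift_neighbour k i l :
  f (alpha i) (alpha l) = -1 ->
  Phi (shift k (alpha i)) -> Phi (shift k (alpha l)).
Proof.
move=> il /(Phi_shift_refl l)/(Phi_shift_refl i)/Phi_eq; apply; congr shift.
by rewrite !reflE !symfE (symfC f (alpha l)) il norm2 //; vector_ring.
Qed.

Let shift_simple k i : Phi (shift k (alpha i)) -> Phi (shift k (alpha t)).
Proof.
move: i; apply: (simple_roots_connected msr t_unique) => // i l il IH.
by move=> /(shift_neighbour (etrans (symfC f _ _) il)).
Qed.

Let shift_add k l : Phi (shift k (alpha t)) -> Phi (shift l (alpha t)) ->
  Phi (shift (k + l) (alpha t)).
Proof.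
move=> tk tl; have [i ti] := simple_root_neighbour msr t_unique t.
have il := shift_neighbour ti tl.
move: (grs_refl grs tk il) => /(Phi_refl i)/Phi_eq; apply.
rewrite refl_norm2 ?norm2 // /shift rmorphD.
rewrite !symfE !a_null !marking_null (symfC f (alpha i)) ti norm2 //.
by vector_ring.
Qed.

Let shift_opp k : Phi (shift k (alpha t)) -> Phi (shift (- k) (alpha t)).
Proof.
move=> /(Phi_refl t)/Phi_opp/Phi_eq; apply.
rewrite /shift rmorphN !symfE a_null norm2 //.
by vector_ring.
Qed.

Let shift0 : Phi (shift 0 (alpha t)).
Proof. by rewrite /shift scale0r addr0. Qed.

Let shiftZ (k p : int) :
  Phi (shift k (alpha t)) -> Phi (shift (p * k) (alpha t)).
Proof.
move=> tk; elim/int_rect: p => [|p IH|p IH]; first by rewrite mul0r.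
  by rewrite intS mulrDl mul1r; exact: shift_add.
by rewrite intS opprD mulrDl mulN1r; apply: shift_add => //; exact: shift_opp.
Qed.

(** The integers [k] such that [alpha t + k a] is a root form a group, and
    every root is up to sign [int_comb alpha c + k a] for such a [k], by descent
    to the simple roots and connectedness.  As [a] is in the root lattice and
    independent of the simple roots, this group contains 1. *)
Lemma shifted_root : Phi (alpha t + a).
Proof.
have L_shift x : zspan Phi x ->
    exists c k, x = int_comb alpha c + k%:~R *: a /\ Phi (shift k (alpha t)).
  move: x; apply: zspan_ind => [|x y [c [k [-> tk]]] [d [l [-> tl]]]|p x Phix].
  - exists (fun=> 0), 0; split=> //; rewrite scale0r addr0 /int_comb big1 //.
    by move=> i _; rewrite scale0r.
  - exists (fun i => c i + d i), (k + l); split; last exact: shift_add.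
    rewrite rmorphD scalerDl addrACA; congr (_ + _).
    by rewrite -big_split; apply: eq_bigr => i _; rewrite rmorphD scalerDl.
  have [c [k [c2 xE]]] := root_positive_part Phix.
  have tk : Phi (shift k (alpha t)).
    have ck : Phi (shift k (int_comb alpha c)).
      by case: xE Phix => -> // /Phi_opp; rewrite opprK.
    move: c2 ck; apply: (simple_reflection_ind msr
      (P := fun y => Phi (shift k y) -> Phi (shift k (alpha t)))) => [i|i y IH].
      exact: shift_simple.
    by move=> /(Phi_shift_refl i); rewrite reflK ?norm2.
  case: xE => ->.
    exists (fun i => p * c i), (p * k); split; last exact: shiftZ.
    by rewrite int_combZ rmorphM -scalerA scalerDr.
  exists (fun i => - p * c i), (- p * k); split; last exact: shiftZ.
  by rewrite int_combZ rmorphM -scalerA -scalerDr rmorphN scaleNr scalerN.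
have [c [k [aE tk]]] := L_shift _ marking_zspan.
have c0 i : c i = 0.
  have := congr1 pi aE.
  rewrite linearD linearZ /= pi_a scaler0 addr0 pi_int_comb.
  move=> cE; apply: (beta_free (d := fun=> 0)).
  by rewrite -cE /int_comb big1 // => l _; rewrite scale0r.
have k1 : k = 1.
  apply/eqP; rewrite -(eqr_int R) -subr_eq0; have := marking_neq0.
  apply: contraR => k1; rewrite -(inj_eq (scalerI k1)) scaler0 scalerBl scale1r.
  rewrite {2}aE /int_comb big1 ?add0r ?subrr // => i _.
  by rewrite c0 scale0r.
by apply: Phi_eq tk _; rewrite /shift k1 scale1r.
Qed.

End Shift.

End EllipticRoots.

(** * The central extension *)

(** The space [tilde V] is represented by any space [T] that is spanned by an
    isometric copy of [V] and one vector [b'] with the products of the dual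
    partner of [b]. *)
Section CentralExtension.
Variables (R : realType) (n : nat) (V T : vectType R).
Variables (f : {symmetric V}) (F : {symmetric T}) (j : {linear V -> T}).
Variables (Phi : set V) (a : V) (alpha : 'I_n.+1 -> V) (m : 'I_n.+1 -> nat).
Variables (t : 'I_n.+1) (b' : T).
Let b := int_comb alpha m.
Let A := range (ext_roots alpha t a).

Hypothesis norm2 : forall x, Phi x -> f x x = 2.
Hypothesis form_int : forall x y, Phi x -> Phi y -> f x y \is a Num.int.
Hypothesis msr : marked_simple_roots f alpha m.
Hypothesis t_unique : forall i, m i = m t -> i = t.
Hypothesis A_roots : A `<=` Phi.
Hypothesis a_null : forall y, f a y = 0.
Hypothesis b_null : forall y, f b y = 0.
Hypothesis a_neq0 : a != 0.
Hypothesis positive_part : forall x, Phi x ->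
  exists (c : 'I_n.+1 -> nat) (k : int),
    f (int_comb alpha c) (int_comb alpha c) = 2 /\
    (x = int_comb alpha c + k%:~R *: a \/ x = - (int_comb alpha c + k%:~R *: a)).
Hypothesis null_lattice : forall x, zspan Phi x -> (forall y, f x y = 0) ->
  exists k l : int, x = k%:~R *: b + l%:~R *: a.

Hypothesis j_inj : injective j.
Hypothesis j_isometry : forall x y, F (j x) (j y) = f x y.
Hypothesis j_b'_span : forall v, exists x c, v = j x + c *: b'.
Hypothesis b'_isotropic : F b' b' = 0.
Hypothesis a_b' : F (j a) b' = 0.
Hypothesis b_b' : F (j b) b' = 1.
Hypothesis alpha0_b' : F (j (alpha ord0)) b' = 1.
Hypothesis alpha_b'_int : forall i, F (j (alpha i)) b' \is a Num.int.

Let W := weyl_group f Phi.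
Let tW := weyl_group F (j @` A).

Let stW : subgroup tW. Proof. exact: generated_subgroup. Qed.

Let jD x y : j (x + y) = j x + j y. Proof. exact: linearD. Qed.

Let jZ c x : j (c *: x) = c *: j x. Proof. exact: linearZ. Qed.

Let A2 x : A x -> f x x = 2. Proof. by move=> /A_roots/norm2. Qed.

Let jA2 x : (j @` A) x -> F x x = 2.
Proof. by move=> [y /A2 y2 <-]; rewrite j_isometry. Qed.

Let A_alpha i : A (alpha i). Proof. by exists (Some i). Qed.

Let ja_null v : F (j a) v = 0.
Proof.
have [x [c ->]] := j_b'_span v.
by rewrite !symfE j_isometry a_null a_b' mulr0 addr0.
Qed.

Let jE c : j (int_comb alpha c) = int_comb (j \o alpha) c.
Proof. by rewrite linear_sum; apply: eq_bigr => i _; rewrite jZ. Qed.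

Let msrT : marked_simple_roots F (j \o alpha) m.
Proof.
split=> [i|i k|i k ik|i|i|c c_null] /=; rewrite -?jE ?j_isometry.
- exact: msr_norm msr i.
- exact: msr_int msr i k.
- exact: msr_le0 msr _ _ ik.
- exact: msr_gt0 msr i.
- exact: msr_null msr i.
by apply: (msr_multiple msr) => i; have := c_null i; rewrite /= -jE j_isometry.
Qed.

Let tW_refl x : A x -> reflected F tW (j x).
Proof.
move=> Ax; have [|g gE] := @reflection_GL R T F (j x).
  by rewrite j_isometry A2 // pnatr_eq0.
by exists g => //; apply: sub_gen_smallest; exists (j x) => //; exists x.
Qed.

Let tW_transvection c : transvected F (j a) tW (j (int_comb alpha c)).
Proof.
rewrite jE; apply: (transvected_int_comb ja_null stW msrT t_unique) => [i|].
  exact: tW_refl.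
apply: transvected_of_reflected => //; first by rewrite (msr_norm msrT).
  exact: tW_refl.
by rewrite /= -jD; apply: tW_refl; exists None.
Qed.

Let tW_int_comb (c : 'I_n.+1 -> nat) :
  f (int_comb alpha c) (int_comb alpha c) = 2 ->
  reflected F tW (j (int_comb alpha c)).
Proof.
rewrite -j_isometry jE => c2.
apply: (reflected_int_comb stW msrT) => // i; exact: tW_refl.
Qed.

Let tW_root x : Phi x -> reflected F tW (j x).
Proof.
move=> /positive_part[c [k [c2 xE]]]; rewrite -j_isometry in c2.
have ck : reflected F tW (j (int_comb alpha c + k%:~R *: a)).
  rewrite jD jZ; apply: reflected_shift => //.
  by apply: tW_int_comb; rewrite -j_isometry.
case: xE => -> //; rewrite linearN; apply: reflected_opp => //.
rewrite jD jZ !symfE c2 !ja_null (symfC F _ (j a)) ja_null.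
by ring.
Qed.

Let weyl_subset : weyl_group f A `<=` W.
Proof.
apply: smallest_sub; first exact: generated_subgroup.
by move=> g [x /A_roots Phix gE]; apply: sub_gen_smallest; exists x.
Qed.

(** The restrictions of the elements of [tW] generate all of [W] because every
    reflection in a root lifts. *)
Lemma extended_roots_restriction : exists phi : GL T -> GL V,
  [/\ forall w, tW w -> forall v, j (phi w v) = w (j v), hom_on tW phi
    & phi @` tW = W].
Proof.
have [r [rE rM rW]] := weyl_group_restriction j_inj j_isometry A2.
exists r; split=> //; rewrite -/tW in rE rM rW; rewrite rW.
apply/seteqP; split; first exact: weyl_subset.
apply: smallest_sub; first exact: generated_subgroup.
move=> g [x Phix gE]; rewrite -rW; have [h Wh hE] := tW_root Phix.
exists h => //; apply: GL_eq => v; apply: j_inj; rewrite rE // hE gE.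
have x2 := norm2 Phix.
rewrite (refl_norm2 _ x2) refl_norm2 ?j_isometry //.
by rewrite linearB jZ.
Qed.

Let z_exists : exists z : int -> GL T, forall k, tW (z k) /\
  forall v, z k v = v - (k%:~R * F (j b) v) *: j a.
Proof.
have ex k : exists g : GL T, tW g /\
    forall v, g v = v - (k%:~R * F (j b) v) *: j a.
  have [g Wg gE] := transvectedZ ja_null stW k (tW_transvection m).
  by exists g; split=> // v; rewrite gE symfZl.
by exists (fun k => projT1 (cid (ex k))) => k; exact: (projT2 (cid (ex k))).
Qed.

(** The span of the root lattice and [b']: preserved because roots have integral
    products with [b']. *)
Let lattice v := exists (x : V) (k : int), zspan Phi x /\ v = j x + k%:~R *: b'.

Let int_on_lattice x : A x -> forall v, lattice v -> F (j x) v \is a Num.int.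
Proof.
move=> Ax v [y [k [Ly ->]]]; rewrite !symfE j_isometry rpredD //.
  apply: (zspan_ind (P := fun y => f x y \is a Num.int)) Ly
    => [|u w fu fw|l u Phiu].
  - by rewrite -(scale0r a) symfZr mul0r rpred0.
  - by rewrite symfDr rpredD.
  - by rewrite symfZr rpredM ?intr_int // form_int //; exact: A_roots.
rewrite rpredM ?intr_int //; case: Ax => -[i|] _ <- /=.
  exact: alpha_b'_int.
by rewrite jD symfDl a_b' addr0; exact: alpha_b'_int.
Qed.

Let lattice_stable w : tW w -> forall v, lattice (w v) <-> lattice v.
Proof.
apply: weyl_group_stable => // _ v [x Ax <-] Lv.
rewrite refl_norm2 ?j_isometry ?A2 //.
have [p ->] := intrP (int_on_lattice Ax Lv); have [y [k [Ly ->]]] := Lv.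
exists (y + (- p)%:~R *: x), k; split; last first.
  by rewrite jD jZ rmorphN; vector_ring.
by apply: zspan_add => //; apply/zspanZ/zspan_mem/A_roots.
Qed.

(** An element that fixes [V] is determined by [w b' - b']; this lies in the
    root lattice and is orthogonal to [V], so it is an integral combination of
    [a] and [b], and [F b' b'] being preserved leaves only [a]. *)
Let trivial_restriction w : tW w -> (forall v, w (j v) = j v) ->
  exists k : int, forall v, w v = v - (k%:~R * F (j b) v) *: j a.
Proof.
move=> Ww wj; have isom := weyl_group_isometry jA2 Ww.
have Lb' : lattice b'.
  exists 0, 1; rewrite linear0 add0r scale1r; split=> //.
  by exists [::]; rewrite ?big_nil.
have [x [k [Lx wb']]] := (lattice_stable Ww b').2 Lb'.
have wb'_j v : F (w b') (j v) = F b' (j v) by rewrite -{1}(wj v) isom.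
have k1 : (k%:~R : R) = 1.
  have := wb'_j b; rewrite wb' !symfE j_isometry (symfC f x) b_null add0r.
  by rewrite (symfC F b') b_b' mulr1.
rewrite k1 scale1r in wb'.
have x_null y : f x y = 0.
  have /eqP := wb'_j y; rewrite wb' !symfE j_isometry.
  by rewrite -subr_eq0 addrK => /eqP.
have x_b' : F (j x) b' = 0.
  have := isom b' b'; rewrite wb' !symfE j_isometry x_null b'_isotropic.
  by rewrite (symfC F b') => ?; lra.
have [p [q xE]] := null_lattice Lx x_null.
have p0 : (p%:~R : R) = 0.
  move: x_b'; rewrite xE jD !jZ !symfE b_b' a_b'.
  by rewrite mulr0 addr0 mulr1.
rewrite xE p0 scale0r add0r jZ in wb'.
exists (- q) => v; have [y [c ->]] := j_b'_span v.
rewrite [LHS]linearD [in LHS]linearZ /= wj wb'.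
rewrite !symfE j_isometry b_null b_b' rmorphN.
by vector_ring.
Qed.

Let tE := Eichler_Siegel F j.

(** The two lifts are the transvection [E (a (x) alpha 0)] and the translation
    [s_(alpha 0) s_(b - alpha 0)] by [b]; the two products send [b'] to vectors
    that differ by [2 *: j a], where 2 is the norm of [alpha 0]. *)
Let nonsplit_lifts (phi : GL T -> GL V) :
  (forall w, tW w -> forall v, j (phi w v) = w (j v)) ->
  exists g h : GL T, [/\ tW g, tW h, commute (phi g) (phi h) & ~ commute g h].
Proof.
move=> phiE; pose x := j (alpha ord0).
pose c k := (m k - (k == ord0))%N.
have cE : int_comb alpha c = b + (-1)%:~R *: alpha ord0.
  rewrite int_comb_shift; congr int_comb; apply/funext => k; rewrite /c.
  by have := msr_gt0 msr k; case: (k == ord0); lia.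
have c2 : f (int_comb alpha c) (int_comb alpha c) = 2.
  rewrite cE !symfE !b_null (symfC f _ b) b_null (msr_norm msr) rmorphN.
  by ring.
have x2 : F x x = 2 by rewrite j_isometry (msr_norm msr).
have [g Wg gE] : transvected F (j a) tW x.
  have -> : x = j b + - j (int_comb alpha c).
    by rewrite /x cE !(jD, jZ) rmorphN; vector_ring.
  by apply: transvected_add => //; last apply: transvected_opp => //;
    exact: tW_transvection.
have [s Ws sE] : reflected F tW x by exact: tW_refl.
have [s' Ws' s'E] := tW_int_comb c2.
have jc : j (int_comb alpha c) = j b - x.
  by rewrite cE jD jZ rmorphN scaleNr scale1r.
have jc2 : F (j b - x) (j b - x) = 2 by rewrite -jc j_isometry.
have hE v : (s * s')%g v = v - F (j b - x) v *: (j b - x)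
    - F x (v - F (j b - x) v *: (j b - x)) *: x.
  by rewrite GL_mulE sE s'E jc refl_norm2 // refl_norm2.
have [_ WM _] := stW; have Wh : tW (s * s')%g by exact: WM.
have b0 v : F (j b) (j v) = 0 by rewrite j_isometry.
have xb : F x (j b) = 0 by rewrite symfC b0.
have xa : F x (j a) = 0 by rewrite symfC ja_null.
have ba : F (j b) (j a) = 0 by rewrite b0.
exists g, (s * s')%g; split=> //.
  apply: GL_eq => v; apply: j_inj; rewrite !GL_mulE !phiE // !hE !gE.
  by rewrite !symfE x2 xb xa ba !b0; vector_ring.
move=> /(congr1 (fun w : GL T => w b')).
rewrite (GL_mulE g) (GL_mulE _ g) !hE !gE.
rewrite !symfE x2 xb xa ba ?b0 b_b' alpha0_b'.
move=> /eqP; rewrite -subr_eq0 (_ : _ - _ = 2 *: j a); last by vector_ring.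
rewrite scaler_eq0 pnatr_eq0 /= => /eqP ja0.
by have /eqP := a_neq0; apply; apply: j_inj; rewrite ja0 linear0.
Qed.

Let transvectionE (g : GL T) x : (forall v, g v = v - F (j x) v *: j a) ->
  gl_val g = tE [:: (a, x)].
Proof.
by move=> gE; apply/lfunP => v; rewrite gE Eichler_SiegelE big_seq1.
Qed.

Lemma nonsplit_central_extension : exists phi : GL T -> GL V,
  (forall w v, tW w -> j (phi w v) = w (j v)) /\
  exists z : GL T,
    [/\ gl_val z = tE [:: (a, b)],
        [set gl_val w | w in generated [set z]]
          = [set tE [:: (a, b *~ k)] | k in [set: int]],
        infinite_cyclic (generated [set z]),
        central_extension tW W (generated [set z]) phi
      & ~ split_extension tW W phi].
Proof.
have [phi [phiE phiM phiW]] := extended_roots_restriction.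
exists phi; split=> [w v Ww|]; first exact: phiE.
have [z zP] := z_exists.
have zE k v : z k v = v - (k%:~R * F (j b) v) *: j a by have [_ ->] := zP k.
have zD i k : z (i + k) = (z i * z k)%g.
  apply: GL_eq => v; rewrite GL_mulE !zE rmorphD !symfE.
  by rewrite (symfC F _ (j a)) ja_null; vector_ring.
have z_tE k : gl_val (z k) = tE [:: (a, b *~ k)].
  by apply: transvectionE => v; rewrite zE -scaler_int jZ symfZl.
have z_cyc := generated_cyclic zD.
have z_inj : injective z.
  move=> i k /(congr1 (fun w : GL T => w b')); rewrite !zE b_b' !mulr1.
  move=> /addrI/oppr_inj/eqP; rewrite -subr_eq0 -scalerBl scaler_eq0.
  have /negPf -> : j a != 0.
    by apply: contra_neq a_neq0 => ja0; apply: j_inj; rewrite ja0 linear0.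
  by rewrite orbF subr_eq0 eqr_int => /eqP.
have z_central k w : tW w -> commute (z k) w.
  move: w; apply: smallest_sub; first exact: subgroup_centralizer.
  move=> g [_ [x Ax <-] gE]; apply: GL_eq => v; rewrite !GL_mulE !zE !gE.
  rewrite !refl_norm2 ?j_isometry ?A2 // !symfE j_isometry b_null.
  by rewrite (symfC F _ (j a)) ja_null; vector_ring.
have central : central_extension tW W (generated [set z 1]) phi.
  split=> //; rewrite z_cyc; last by move=> _ w [k _ <-]; exact: z_central.
  apply/seteqP; split=> [w [Ww /= phiw]|_ [k _ <-]].
    have [v|k wE] := trivial_restriction Ww.
      by rewrite -phiE // phiw GL_oneE.
    by exists k => //; apply: GL_eq => v; rewrite zE wE.
  have [Wz _] := zP k; split=> //=; apply: GL_eq => v; apply: j_inj.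
  by rewrite phiE // zE GL_oneE j_isometry b_null mulr0 scale0r subr0.
exists (z 1); split=> //.
- rewrite z_cyc; apply/seteqP; split=> [_ [_ [k _ <-] <-]|_ [k _ <-]].
    by exists k; rewrite ?z_tE.
  by exists (z k); [exists k | rewrite z_tE].
- exists z => //; rewrite z_cyc; split=> [k _|k l _ _|//]; last exact: z_inj.
  by exists k.
have [g [h [Wg Wh cphi ncgh]]] := nonsplit_lifts phiE.
exact: noncommuting_lifts_nonsplit stW central Wg Wh cphi ncgh.
Qed.

End CentralExtension.

(** * The hyperbolic covers *)

Section HyperbolicCovers.
Variables (R : realType) (n : nat) (V hV : vectType R).
Variables (f : {symmetric V}) (hf : {symmetric hV}) (inc : 'Hom(V, hV)).

Fact tilde_inj_linear b' : linear (tilde_inj inc b').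
Proof. by move=> k x y; rewrite /tilde_inj !linearP. Qed.

HB.instance Definition _ b' := GRing.isLinear.Build R V
  (subvs_of (tilde_space inc b')) *:%R (tilde_inj inc b') (tilde_inj_linear b').

Variables (alpha : 'I_n.+1 -> V) (m : 'I_n.+1 -> nat) (a : V) (a' b' : hV).
Let Vfin := <<codom (fun i : 'I_n => alpha (lift ord0 i))>>%VS.
Let b := int_comb alpha m.
Hypothesis a_null : forall y, f a y = 0.
Hypothesis m0 : m ord0 = 1%N.
Hypothesis hyp : hyperbolic_extension f hf inc n Vfin a b a' b'.

Let T := subvs_of (tilde_space inc b').
Let F := tilde_form hf inc b'.
Let j := tilde_inj inc b'.

Lemma tilde_inj_inj : injective j.
Proof.
move=> x y /(congr1 vsval); rewrite !tilde_injE.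
by have /eqP/lker0P := hyp_inj hyp; apply.
Qed.

Lemma tilde_inj_isometry x y : F (j x) (j y) = f x y.
Proof.
by rewrite /F /tilde_form /= /restr_form !tilde_injE (hyp_isometry hyp).
Qed.

Lemma tilde_b'_mem : b' \in tilde_space inc b'.
Proof. exact: subvP (addvSr _ _) _ (memv_line _). Qed.

Let tb' : T := vsproj _ b'.

Let tb'E : vsval tb' = b'. Proof. by rewrite vsprojK // tilde_b'_mem. Qed.

Let formE (u v : T) : F u v = hf (vsval u) (vsval v). Proof. by []. Qed.

Let j_b' x : F (j x) tb' = hf (inc x) b'.
Proof. by rewrite formE tb'E tilde_injE. Qed.

Lemma tilde_span (v : T) : exists x c, v = j x + c *: tb'.
Proof.
have /memv_addP[_ /memv_imgP[x _ ->] [_ /vlineP[c ->] vE]] := subvsP v.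
by exists x, c; apply: subvs_inj; rewrite linearD linearZ /= tb'E tilde_injE.
Qed.

Let E2_E3 x y : x \in (<[inc a]> + <[a']>)%VS ->
  y \in (<[inc b]> + <[b']>)%VS -> hf x y = 0.
Proof. by have [_ _ _ _ /orthovP] := hyp_decomposition hyp; apply. Qed.

Let E1_E3 x y : x \in (inc @: Vfin)%VS ->
  y \in (<[inc b]> + <[b']>)%VS -> hf x y = 0.
Proof. by have [_ _ _ /orthovP o _] := hyp_decomposition hyp; apply: o. Qed.

Let line1 (x y : hV) : x \in (<[x]> + <[y]>)%VS.
Proof. exact: subvP (addvSl _ _) _ (memv_line _). Qed.

Let line2 (x y : hV) : y \in (<[x]> + <[y]>)%VS.
Proof. exact: subvP (addvSr _ _) _ (memv_line _). Qed.

Lemma b'_isotropic : F tb' tb' = 0.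
Proof. by rewrite formE tb'E; have [_ -> _] := hyp_pair_b hyp. Qed.

Lemma a_b'_orthogonal : F (j a) tb' = 0.
Proof. by rewrite j_b'; apply: E2_E3. Qed.

Lemma b_b'_pair : F (j b) tb' = 1.
Proof. by rewrite j_b'; have [] := hyp_pair_b hyp. Qed.

Lemma finite_root_b' i : F (j (alpha (lift ord0 i))) tb' = 0.
Proof.
rewrite j_b'; apply: E1_E3 => //; apply: memv_img; apply: memv_span.
exact: (codom_f (fun i : 'I_n => alpha (lift ord0 i))).
Qed.

(** [b] has product 1 with [b'] and differs from [alpha 0] by a vector of the
    span of the finite roots, which is orthogonal to [b']. *)
Lemma affine_root_b' : F (j (alpha ord0)) tb' = 1.
Proof.
rewrite -b_b'_pair !j_b' linear_sum symf_suml big_ord_recl m0 scale1r.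
rewrite big1 ?addr0 // => i _.
by rewrite linearZ /= symfZl -j_b' finite_root_b' mulr0.
Qed.

Lemma root_b'_int i : F (j (alpha i)) tb' \is a Num.int.
Proof.
have [k|->] := unliftP ord0 i.
  by move=> ->; rewrite finite_root_b' rpred0.
by rewrite affine_root_b' rpred1.
Qed.

Lemma hat_span (v : hV) : exists x c d, v = inc x + c *: b' + d *: a'.
Proof.
have [full _ _ _ _] := hyp_decomposition hyp.
have : v \in fullv by exact: memvf.
rewrite -full => /memv_addP[_ /memv_addP[_ /memv_imgP[x _ ->] [y Ey ->]]
  [z Ez ->]].
have /memv_addP[_ /vlineP[k ->] [_ /vlineP[k' ->] ->]] := Ey.
have /memv_addP[_ /vlineP[l ->] [_ /vlineP[l' ->] ->]] := Ez.
exists (x + k *: a + l *: b), l', k'.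
by rewrite !linearD !linearZ /=; vector_ring.
Qed.

(** The orthogonal complement of [tilde V] is the line of [a], so such an
    isometry moves [a'] by a multiple of [a], which must vanish since [a'] stays
    isotropic. *)
Lemma isometry_fixing_tilde (h : GL hV) :
  (forall u v, hf (h u) (h v) = hf u v) ->
  (forall v : T, h (vsval v) = vsval v) -> h = 1%g.
Proof.
move=> isom h_fix.
have inc_fix x : h (inc x) = inc x by rewrite -(tilde_injE inc b') h_fix.
have b'_fix : h b' = b' by rewrite -tb'E h_fix.
have [a_iso a'_iso aa'] := hyp_pair_a hyp.
have [d ha'] : exists d, h a' = a' + d.
  by exists (h a' - a'); rewrite addrC subrK.
have d_fix u : h u = u -> hf d u = 0.
  by move=> hu; have := isom a' u; rewrite ha' hu symfDl => ?; lra.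
have d_inc x : hf d (inc x) = 0 by exact: d_fix.
have d_b' : hf d b' = 0 by exact: d_fix.
have a_b' : hf (inc a) b' = 0 by apply: E2_E3.
have a_inc x : hf (inc a) (inc x) = 0 by rewrite (hyp_isometry hyp).
have dE : d = hf d a' *: inc a.
  apply/eqP; rewrite -subr_eq0 -memv0.
  have /eqP <- := hyp_nondegenerate hyp; apply/mem_orthovP => v _.
  have [x [c [k ->]]] := hat_span v.
  by rewrite !symfE d_inc d_b' a_b' a_inc aa'; ring.
have d0 : d = 0.
  have := isom a' a'; rewrite ha' dE !symfE a'_iso a_iso (symfC hf a') aa'.
  move=> da0; have -> : hf d a' = 0 by lra.
  by rewrite scale0r.
apply: GL_eq => v; rewrite GL_oneE; have [x [c [k ->]]] := hat_span v.
by rewrite !linearD !linearZ /= inc_fix b'_fix ha' d0 addr0.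
Qed.

Lemma tilde_hat_isomorphic (A : set V) : (forall x, A x -> f x x = 2) ->
  isomorphic (weyl_group F (j @` A)) (weyl_group hf (inc @` A)).
Proof.
move=> A2; have -> : inc @` A = vsval @` (j @` A).
  by rewrite image_comp; apply: eq_imagel => x _; rewrite /= tilde_injE.
have jA2 x : (j @` A) x -> F x x = 2.
  by move=> [y /A2 y2 <-]; rewrite tilde_inj_isometry.
have isometry (u v : T) : hf (vsval u) (vsval v) = F u v by [].
have [r [rE rM rW]] := weyl_group_restriction subvs_inj isometry jA2.
apply: isomorphic_inv rM rW _; first exact: generated_subgroup.
move=> h Wh rh; apply: isometry_fixing_tilde => [|v].
  apply: weyl_group_isometry Wh => _ [x /jA2 x2 <-].
  by rewrite isometry.
by rewrite -rE // rh GL_oneE.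
Qed.

End HyperbolicCovers.

Theorem proposition3p10 (R : realType) (n : nat)
    (V : vectType R) (f : {symmetric V}) (Phi : set V)
    (U : {vspace V}) (a : V)
    (VU : vectType R) (fU : {symmetric VU}) (pi : 'Hom(V, VU))
    (beta : 'I_n.+1 -> VU) (m : 'I_n.+1 -> nat) (alpha : 'I_n.+1 -> V)
    (t : 'I_n.+1)
    (hV : vectType R) (hf : {symmetric hV}) (inc : 'Hom(V, hV)) (a' b' : hV) :
  let b := \sum_i alpha i *+ m i in
  let Vfin := <<codom (fun i : 'I_n => alpha (lift ord0 i))>>%VS in
  let alpha_star := ext_roots alpha t a in
  elliptic f n Phi ->
  (forall x, Phi x -> f x x = 2) ->
  marking f Phi U a ->
  quotient_space f U fU pi ->
  affine_root_basis f fU pi Phi beta m ->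
  (forall i, Phi (alpha i) /\ pi (alpha i) = beta i) ->
  tubular m t ->
  hyperbolic_extension f hf inc n Vfin a b a' b' ->
  let j := tilde_inj inc b' in
  let W := weyl_group f Phi in
  let tW := weyl_group (tilde_form hf inc b') (range (j \o alpha_star)) in
  let hW := weyl_group hf (range (inc \o alpha_star)) in
  let tE := Eichler_Siegel (tilde_form hf inc b') j in
  (exists phi : GL (subvs_of (tilde_space inc b')) -> GL V,
     (forall w v, tW w -> j (phi w v) = w (j v)) /\
     exists z : GL (subvs_of (tilde_space inc b')),
       [/\ gl_val z = tE [:: (a, b)],
           [set gl_val w | w in generated [set z]]
             = [set tE [:: (a, b *~ k)] | k in [set: int]],
           infinite_cyclic (generated [set z]),
           central_extension tW W (generated [set z]) phi
         & ~ split_extension tW W phi])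
  /\ isomorphic tW hW.
Proof.
move=> b Vfin alpha_star [grs _ _ _ _] norm2 mark quot arb lifts tub hyp.
move=> j W tW hW tE.
have bE : b = int_comb alpha m.
  by apply: eq_bigr => i _; rewrite scaler_int.
have t_unique i : m i = m t -> i = t.
  by move=> mi; apply/tub; rewrite mi; apply/tub.
have a_null := marking_null mark.
have A_roots : range alpha_star `<=` Phi.
  move=> _ [[i|] _ <-] /=; first by have [] := lifts i.
  exact: (shifted_root grs norm2 mark quot arb lifts t_unique).
have A2 x : range alpha_star x -> f x x = 2 by move=> /A_roots/norm2.
have m0 := arb_mark0 arb.
have tWE : tW = weyl_group (tilde_form hf inc b') (j @` range alpha_star).
  by congr weyl_group; rewrite image_comp.
have hWE : hW = weyl_group hf (inc @` range alpha_star).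
  by congr weyl_group; rewrite image_comp.
clearbody b tW hW; subst b tW hW; split; last first.
  exact: (tilde_hat_isomorphic a_null hyp A2).
apply: (@nonsplit_central_extension R n V _ f (tilde_form hf inc b')
  (tilde_inj inc b') Phi a alpha m t (vsproj _ b')) => //.
- exact: root_form_int grs norm2.
- exact: (simple_roots_marked grs norm2 mark quot arb lifts).
- exact: (null_combination_null mark quot arb lifts).
- exact: marking_neq0 mark.
- exact: (root_positive_part norm2 mark quot arb lifts).
- exact: (null_lattice mark quot arb lifts).
- exact: tilde_inj_inj hyp.
- exact: tilde_inj_isometry hyp.
- exact: tilde_span.
- exact: b'_isotropic hyp.
- exact: a_b'_orthogonal hyp.
- exact: b_b'_pair hyp.
- exact: affine_root_b' m0 hyp.
- exact: root_b'_int m0 hyp.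
Qed.
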